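(* Let $S$ be a (connected) oriented closed surface with a cellular decomposition $\mathcal{D}$ and a weight $\Phi:E\to(0,\pi)$. In the hyperbolic background geometry, for any prescribed vertex curvature $\bar K=(\bar K_1,\dots,\bar K_N)\in(-\infty,2\pi)^N$, the prescribed flow $$\frac{dr_i}{dt}=(\bar K_i-K_i)\sinh r_i,\qquad i=1,\dots,N,$$ has, for any initial circle pattern $r(0)\in\mathbb{R}^N_{>0}$, a unique solution $r(t)$, which exists for all time $t\ge0$. Moreover: (1) If $2\pi-\mathcal{L}(\mathcal{D},\Phi)_i<\bar K_i<2\pi$ at each vertex $i\in V$, then there is a unique ideal circle pattern $\bar r\in\mathbb{R}^N_{>0}$ with curvature $K(\bar r)=\bar K$, and the solution to the prescribed flow converges exponentially fast to $\bar r$ as $t\to+\infty$. (2) If $\bar K_i\le2\pi-\mathcal{L}(\mathcal{D},\Phi)_i$ at each vertex $i\in V$, then there is no circle pattern $\bar r\in\mathbb{R}^N_{>0}$ with curvature $K(\bar r)=\bar K$. Moreover, if $\bar K_i<2\pi-\mathcal{L}(\mathcal{D},\Phi)_i$ at each vertex $i\in V$, then the solution $r(t)$ to the prescribed flow converges exponentially fast to $0$ as $t\to+\infty$.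
   Context: $V=\{v_1,\dots,v_N\}$ and $E$ are the vertices and edges of $\mathcal{D}$; $\Phi_{ij}$ is the value of $\Phi$ on the edge $e_{ij}$ joining $v_i,v_j$. Sums $\sum_{j\sim i}$ run over the neighbours of $i$, i.e. over the edges at $i$ (one term for each edge-end at $v_i$). The character at $i$ is $\mathcal{L}(\mathcal{D},\Phi)_i=\sum_{j\sim i}\Phi_{ij}$. A circle pattern (ideal circle pattern) is identified with its radius vector $r=(r_1,\dots,r_N)\in\mathbb{R}^N_{>0}$. In the hyperbolic background geometry, to an edge $e_{ij}$ one associates a hyperbolic triangle whose vertices are the centers $i,j$ of two circles of radii $r_i,r_j$ meeting with exterior intersection angle $\Phi_{ij}$ and one of the intersection points of the two circles. Its sides have lengths $r_i$ (from $i$ to the intersection point), $r_j$ (from $j$ to the intersection point) and $l_{ij}=\cosh^{-1}(\cosh r_i\cosh r_j+\sinh r_i\sinh r_j\cos\Phi_{ij})$. Let $\theta_i^j=\theta_i^j(r_i,r_j)\in(0,\pi)$ be its inner angle at the center $i$. The vertex curvature is $K_i=K_i(r)=2\pi-2\sum_{j\sim i}\theta_i^j$, and $K(r)=(K_1(r),\dots,K_N(r))$. ''Exponentially fast'' means that the distance to the limit is at most $c_1e^{-c_2t}$ for some constants $c_1,c_2>0$. *)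

(* Defs.v *)
From HB Require Import structures.
From mathcomp Require Export all_boot all_order all_algebra all_fingroup.
From mathcomp Require Export all_classical all_reals all_analysis.
Export Order.TTheory GRing.Theory Num.Theory.
Export numFieldNormedType.Exports.

Set Implicit Arguments.
Unset Strict Implicit.
Unset Printing Implicit Defensive.

Local Open Scope classical_set_scope.
Local Open Scope ring_scope.

(** A cellular decomposition, with vertices ['I_N], of a connected oriented
    closed surface, given by its combinatorial map.  A dart is an oriented edge,
    i.e. an edge-end: [org d] is the vertex at which it starts, [opp d] is the
    same edge with the other orientation, and [vrot] rotates positively the
    darts around each vertex.  The edges are the orbits of [opp], the (open
    disc) faces correspond to the orbits of [d |-> vrot (opp d)], and the
    surface is recovered by gluing one disc along each of those.  Loops and
    multiple edges are allowed, and so is the decomposition of the sphere into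
    one vertex and one face (no darts).  The surface is connected if and only
    if the 1-skeleton is. *)
Record cellular_decomposition (N : nat) := CellularDecomposition {
  dart : finType;
  org : dart -> 'I_N;
  opp : {perm dart};
  vrot : {perm dart};
  oppK : forall d, opp (opp d) = d;
  opp_neq : forall d, opp d != d;
  vrot_org : forall d d', (org d == org d') = (d' \in porbit vrot d);
  vertices_nonempty : (0 < N)%N;
  skeleton_connected : forall i j : 'I_N,
    connect [rel i' j' | [exists d, (org d == i') && (org (opp d) == j')]] i j
}.

Definition edge N (D : cellular_decomposition N) : finType :=
  {e : {set dart D} | e \in porbits (opp D)}.

Lemma porbit_in_porbits N (D : cellular_decomposition N) (d : dart D) :
  porbit (opp D) d \in porbits (opp D).
Proof. exact: imset_f. Qed.

Definition edge_of N (D : cellular_decomposition N) (d : dart D) : edge D :=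
  exist _ (porbit (opp D) d) (porbit_in_porbits d).

Section Hyperbolic.
Variable R : realType.

Definition cosh (x : R) : R := (expR x + expR (- x)) / 2.

Definition sinh (x : R) : R := (expR x - expR (- x)) / 2.

(** The inverse of [cosh] on [[0, +oo[], used at arguments [>= 1]. *)
Definition arcosh (x : R) : R := ln (x + Num.sqrt (x ^+ 2 - 1)).

(** The inner angle, between the sides of lengths [a] and [b], of the
    hyperbolic triangle with side lengths [a], [b], [c], by the hyperbolic law
    of cosines
    [cosh c = cosh a * cosh b - sinh a * sinh b * cos (hyp_angle a b c)]. *)
Definition hyp_angle (a b c : R) : R :=
  acos ((cosh a * cosh b - cosh c) / (sinh a * sinh b)).

(** The distance between the centers of two circles of radii [a] and [b] with
    exterior intersection angle [phi]. *)
Definition center_dist (phi a b : R) : R :=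
  arcosh (cosh a * cosh b + sinh a * sinh b * cos phi).

(** The angle at the center of the circle of radius [a]; the opposite side is
    the one of length [b]. *)
Definition theta (phi a b : R) : R := hyp_angle a (center_dist phi a b) b.

Variables (N : nat) (D : cellular_decomposition N) (Phi : edge D -> R).

(** Sums over the neighbours of [i] have one term for each dart [d] at [i]; the
    neighbour is [org (opp D d)], so that a loop at [i] contributes twice. *)
Definition character (i : 'I_N) : R :=
  \sum_(d : dart D | org d == i) Phi (edge_of d).

Definition circle_pattern (r : 'rV[R]_N) : Prop := forall i, 0 < r ord0 i.

Definition curvature (r : 'rV[R]_N) : 'rV[R]_N :=
  \row_i (2 * pi - 2 * \sum_(d : dart D | org d == i)
    theta (Phi (edge_of d)) (r ord0 i) (r ord0 (org (opp D d)))).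

(** [f] has derivative [l] at [t] relatively to [A]: the derivative is
    one-sided when [t] is an endpoint of the interval [A]. *)
Definition has_derive_within (A : set R) (f : R -> R) (t l : R) : Prop :=
  (f s - f t) / (s - t) @[s --> within A t^'] --> l.

Definition flow_solution (Kbar : 'rV[R]_N) (A : set R) (r : R -> 'rV[R]_N) :
    Prop :=
  forall t, A t -> circle_pattern (r t) /\
    forall i, has_derive_within A (fun s => r s ord0 i) t
      ((Kbar ord0 i - curvature (r t) ord0 i) * sinh (r t ord0 i)).

(** The norm of ['rV[R]_N] is the maximum norm. *)
Definition cvg_exponentially (r : R -> 'rV[R]_N) (l : 'rV[R]_N) : Prop :=
  exists c1 c2 : R, 0 < c1 /\ 0 < c2 /\
    forall t, 0 <= t -> `|r t - l| <= c1 * expR (- c2 * t).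

End Hyperbolic.

(* Main.v *)
Require Import Defs.
From mathcomp Require Import ring lra.

(** Put [p_i = - ln tanh (r_i / 2)]. The flow becomes [p_i' = K_i - Kbar_i],
    and the angle opposite to the side of parameter [q] in the triangle of
    parameters [p], [q] is [A (q + p) - A (q - p)], where [A x = atan ((e^x
    + cos phi) / sin phi)] is increasing and has an even derivative that
    decreases away from [0] ([theta_tau]). This formula shows that the angle
    is Lipschitz on the whole plane and tends to [0] with [p], uniformly in
    [q]; on positive parameters it decreases with [q], and increases when
    [p] and [q] grow by the same amount; for [p = q] it stays below [phi /
    2], which is its limit at infinity.

    Hence, at a vertex where the maximum norm of the difference of two
    circle patterns is attained, the curvatures push the two values towards
    each other: the flow contracts the maximum norm of [p]. The rest follows
    from a maximum principle for finitely many functions of time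
    ([max_principle]): they stay negative if those that vanish first have a
    negative derivative.

    Global existence is Picard's theorem for a globally Lipschitz field
    ([picard]). Its solution stays positive because all the angles at [i]
    are small when [p_i] is small, so that [p_i' > 0] there. Comparing the
    distance of two solutions with a small affine function of time gives
    uniqueness ([solution_unique]); comparing the distance of a solution to
    an equilibrium with a decreasing exponential gives exponential
    convergence ([solution_cvg_equilibrium]).

    If [0 < 2 pi - Kbar_i] is smaller than the character at each vertex, a
    small constant vector is a subsolution and a large one a supersolution,
    and the supremum of the subsolutions between them is an equilibrium
    ([exists_equilibrium]). It is unique because every constant solution
    converges to it.

    In the opposite case look at the vertex where [p] is minimal: the angles
    there are at most the diagonal ones, so twice their sum is less than the
    character if there is a dart at this vertex. This excludes equilibria
    ([no_equilibrium]) and, when the inequalities are strict, makes the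
    minimum of [p] grow at least linearly ([solution_escape]), so that [r]
    decays exponentially. *)

Set Implicit Arguments.
Unset Strict Implicit.
Unset Printing Implicit Defensive.

Local Open Scope classical_set_scope.
Local Open Scope ring_scope.

(** * Real analysis: monotonicity, one-sided slopes, and a maximum principle *)

Section RealAnalysis.
Variable R : realType.
Implicit Types (f g df : R -> R) (a b t x y : R).

Lemma derive_ge0_le f df a b : a <= b ->
  (forall x, a <= x <= b -> is_derive x 1 f (df x)) ->
  (forall x, a <= x <= b -> 0 <= df x) -> f a <= f b.
Proof.
move=> ab Df df0.
have [x||c] := @MVT_segment R f df a b ab.
- by rewrite in_itv/= => /andP[? ?]; apply: Df; rewrite !ltW.
- apply: derivable_within_continuous => x; rewrite in_itv/= => xab.
  exact: (@ex_derive _ _ _ _ _ _ _ (Df x xab)).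
- rewrite in_itv/= => cab fba; rewrite -subr_ge0 fba mulr_ge0 ?subr_ge0//.
  exact: df0.
Qed.

(** The link between two-sided derivatives and the slopes by which solutions
    of the flow are defined. *)
Lemma is_derive_slopeP f t (l : R) :
  is_derive t 1 f l <-> (f s - f t) / (s - t) @[s --> t^'] --> l.
Proof.
have E (h : R) : h^-1 *: ((f \o shift t) (h *: (1 : R^o)) - f t) =
    (f (t + h) - f t) / (t + h - t).
  rewrite /= /GRing.scale/= mulr1 (addrC h) (addrC t h) addrK mulrC.
  by rewrite (addrC h).
split=> [[df <-]|H].
  have : h^-1 *: ((f \o shift t) (h *: (1 : R^o)) - f t) @[h --> 0^']
      --> 'D_1 f t by exact: df.
  move=> /cvgrPdist_lt H; apply/cvgrPdist_lt => e e0.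
  have /nbhs_ballP[d /= d0 Hd] := H e e0.
  apply/nbhs_ballP; exists d => //= s sd st.
  have := Hd (s - t); rewrite E [t + _]addrC subrK; apply.
    by rewrite /ball/= sub0r opprB.
  by rewrite subr_eq0.
suff Hl : h^-1 *: ((f \o shift t) (h *: (1 : R^o)) - f t) @[h --> 0^'] --> l.
  by apply: DeriveDef; [exact: cvgP Hl|exact: cvg_lim Hl].
move/cvgrPdist_lt : H => H; apply/cvgrPdist_lt => e e0.
have /nbhs_ballP[d /= d0 Hd] := H e e0.
apply/nbhs_ballP; exists d => //= h hd h0.
rewrite E; apply: Hd.
  by move: hd; rewrite /ball/= sub0r opprD addNKr.
by rewrite -subr_eq0 addrAC subrr add0r.
Qed.

Lemma is_derive_continuous f t (l : R) :
  is_derive t 1 f l -> {for t, continuous f}.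
Proof.
by move=> [+ _] => /derivable1_diffP; exact: differentiable_continuous.
Qed.

(** At the infimum of the times at which some [w i] is nonnegative, all the
    [w j] are nonpositive and one of them vanishes; it was negative before,
    which a negative derivative forbids. The time [0] is treated apart, by
    right continuity, because only one-sided derivatives are available
    there. *)
Lemma max_principle (I : finType) (w dw : I -> R -> R) b :
  (forall i, w i 0 < 0) ->
  (forall i, w i x @[x --> 0^'+] --> w i 0) ->
  (forall i t, 0 < t <= b -> is_derive t 1 (w i) (dw i t)) ->
  (forall i t, 0 < t <= b -> w i t = 0 -> (forall j, w j t <= 0) ->
     dw i t < 0) ->
  forall i t, 0 <= t <= b -> w i t < 0.
Proof.
move=> w0 cw Dw dw0 i1 t1 t1b; rewrite ltNge; apply/negP => w1.
pose S := [set t | 0 <= t <= b /\ exists i, 0 <= w i t].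
have S1 : S t1 by split=> //; exists i1.
have lbS : lbound S 0 by move=> s [/andP[]].
have hS : has_inf S by split; [exists t1|exists 0].
pose t0 := inf S.
have t0_le s : S s -> t0 <= s by move=> ?; apply: ge_inf => //; exists 0.
have t0_ge0 : 0 <= t0 by apply: lb_le_inf => //; exists t1.
have t0b : t0 <= b by apply: le_trans (t0_le _ S1) _; case/andP: t1b.
have before s : 0 <= s < t0 -> forall i, w i s < 0.
  move=> /andP[s0 st] i; rewrite ltNge; apply/negP => wi.
  have : t0 <= s by apply: t0_le; split; [lra|exists i].
  by lra.
have after e : 0 < e -> exists2 s, S s & s < t0 + e.
  by move=> e0; have [s Ss se] := inf_adherent e0 hS; exists s.
have t0_gt0 : 0 < t0.
  rewrite lt_neqAle t0_ge0 andbT; apply/eqP => t00.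
  have : \forall x \near 0^'+, forall i, w i x < 0.
    apply: filter_forall => i.
    exact: (cvgr_lt (w i 0) (cw i)).
  move=> /nbhs_ballP[e /= e0 He].
  have [s [/andP[s0 sb] [i wi]] se] := after e e0.
  move: s0; rewrite le_eqVlt => /predU1P[s0|s0].
    by have := w0 i; rewrite s0; lra.
  have : w i s < 0.
    by apply: He => //; rewrite /ball/= sub0r normrN gtr0_norm//; lra.
  by lra.
have Dw0 i : is_derive t0 1 (w i) (dw i t0) by apply: Dw; lra.
have cw0 i := is_derive_continuous (Dw0 i).
have w_le0 i : w i t0 <= 0.
  rewrite leNgt; apply/negP => wi.
  have /nbhs_ballP[e /= e0 He] : \forall x \near t0, 0 < w i x.
    exact: (cvgr_gt (w i t0) (cw0 i)).
  pose s := t0 - Num.min (e / 2) (t0 / 2).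
  have m0 : 0 < Num.min (e / 2) (t0 / 2) by rewrite lt_min !divr_gt0.
  have me : Num.min (e / 2) (t0 / 2) <= e / 2 by rewrite ge_min lexx.
  have mt : Num.min (e / 2) (t0 / 2) <= t0 / 2 by rewrite ge_min lexx orbT.
  have : 0 < w i s by apply: He; rewrite /ball/= /s subKr gtr0_norm//; lra.
  by have : w i s < 0; [apply: before; rewrite /s; lra|lra].
have [i wi] : exists i, w i t0 = 0.
  apply: contrapT => /forallNP wn.
  have : \forall x \near t0, forall i, w i x < 0.
    apply: (@filter_forall _ _ (fun i x => w i x < 0) (nbhs t0)) => i.
    apply: (cvgr_lt (w i t0) (cw0 i) 0).
    by rewrite lt_neqAle w_le0 andbT; apply/eqP; exact: wn.
  move=> /nbhs_ballP[e /= e0 He].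
  have [s Ss se] := after e e0; have ts := t0_le s Ss.
  case: Ss => _ [i wi].
  have : w i s < 0 by apply: He; rewrite /ball/= distrC ger0_norm//; lra.
  by lra.
have dwi : dw i t0 < 0 by apply: dw0 => //; lra.
have /is_derive_slopeP Hs := Dw0 i.
have /nbhs_ballP[e /= e0 He] :
    \forall s \near t0^', (w i s - w i t0) / (s - t0) < 0.
  exact: (cvgr_lt (dw i t0) Hs).
pose s := t0 - Num.min (e / 2) (t0 / 2).
have m0 : 0 < Num.min (e / 2) (t0 / 2) by rewrite lt_min !divr_gt0.
have me : Num.min (e / 2) (t0 / 2) <= e / 2 by rewrite ge_min lexx.
have mt : Num.min (e / 2) (t0 / 2) <= t0 / 2 by rewrite ge_min lexx orbT.
have st : s < t0 by rewrite /s; lra.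
have : (w i s - w i t0) / (s - t0) < 0.
  apply: He; last by rewrite lt_eqF.
  by rewrite /ball/= /s subKr gtr0_norm//; lra.
rewrite wi subr0 nmulr_llt0 ?invr_lt0 ?subr_lt0// => wis.
by have : w i s < 0; [apply: before; rewrite /s; lra|lra].
Qed.

Lemma is_derive_expZ (a c t : R) :
  is_derive t 1 (fun s : R => a * expR (c * s)) (c * (a * expR (c * t))).
Proof.
have D1 : is_derive t 1 (fun z : R => c * z) (c *: 1) by exact: is_deriveZ.
have D2 : is_derive t 1 (a \*: (expR \o (fun z : R => c * z))) _ :=
  is_deriveZ a (@is_derive1_comp R expR (fun z : R => c * z) t _ _
    (is_derive_expR _) D1).
by apply: (is_derive_eq D2); rewrite /GRing.scale/= mulr1; ring.
Qed.

End RealAnalysis.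

(** A positive minimum, halved; the neutral value [1] serves when [I] is
    empty. *)
Lemma exists_below (R : realType) (I : finType) (k : I -> R) :
  (forall i, 0 < k i) -> exists2 e : R, 0 < e & forall i, e < k i.
Proof.
move=> k0; exists ((\big[Num.min/1]_i k i) / 2).
  by rewrite divr_gt0//; elim/big_ind: _ => // x y x0 y0; rewrite lt_min x0.
move=> i; have : \big[Num.min/1]_i k i <= k i by exact: bigmin_le_cond.
by have := k0 i; set m := \big[_/_]_i _; lra.
Qed.

Lemma cvg_within_sub (R : realType) (A : set R) (F G : set_system R)
    (h : R -> R) (l : R) : Filter F -> G `<=` F ->
  F A -> h s @[s --> within A G] --> l -> h s @[s --> F] --> l.
Proof.
move=> FF GF FA H P /H; rewrite /nbhs/= /within/= => /GF.
by apply: filterS2 FA => x Ax; apply.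
Qed.

Lemma slope_continuous_right (R : realType) (f : R -> R) (t l : R) :
  (f s - f t) / (s - t) @[s --> t^'+] --> l -> f s @[s --> t^'+] --> f t.
Proof.
move=> H.
have Hs : s - t @[s --> t^'+] --> (0 : R).
  rewrite -(subrr t); apply: cvgB; last exact: cvg_cst.
  by apply: cvg_at_right_filter; exact: cvg_id.
have : (f s - f t) / (s - t) * (s - t) + f t @[s --> t^'+] --> l * 0 + f t.
  by apply: cvgD; [exact: cvgM|exact: cvg_cst].
rewrite mulr0 add0r; apply: cvg_trans; apply: near_eq_cvg.
near=> s; rewrite divfK ?subrK// subr_eq0 gt_eqF//.
Unshelve. all: by end_near. Qed.

Lemma nbhs_lt_ereal (R : realType) (T : \bar R) (x : R) :
  (x%:E < T)%E -> \forall y \near x, (y%:E < T)%E.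
Proof.
case: T => [T||]; last by rewrite ltNge leNye.
- rewrite lte_fin => xT; near=> y; rewrite lte_fin; near: y; exact: lt_nbhsl.
- by move=> _; near=> y; rewrite ltry.
Unshelve. all: by end_near. Qed.

Lemma row_norm_le (R : realType) (N : nat) (v : 'rV[R]_N) (c : R) : 0 <= c ->
  (forall i, `|v ord0 i| <= c) -> `|v| <= c.
Proof.
move=> c0 vc; rewrite (_ : `|v| = mx_norm v)// mx_normrE.
apply: bigmax_le => // -[k i] _ /=.
by rewrite ord1.
Qed.

(** The exponential bound at the time [c1 / (c2 * `|x - y|)] contradicts [1
    + w <= exp w] unless [x = y]. *)
Lemma cvg_exponentially_cst (R : realType) (N : nat) (x y : 'rV[R]_N) :
  cvg_exponentially (fun=> x) y -> x = y.
Proof.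
move=> [c1 [c2 [c10 [c20 H]]]]; apply/eqP; rewrite -subr_eq0 -normr_le0.
rewrite leNgt; apply/negP => xy.
have t0 : 0 <= c1 / (`|x - y| * c2) by rewrite divr_ge0 ?mulr_ge0// ltW.
have := H _ t0.
rewrite mulNr expRN; set w := c2 * _.
have ew : 1 + w <= expR w by exact: expR_ge1Dx.
have wE : w * `|x - y| = c1 by rewrite /w; field; rewrite !gt_eqF.
rewrite ler_pdivlMr ?expR_gt0// => h.
have : `|x - y| * (1 + w) <= `|x - y| * expR w by rewrite ler_pM2l.
by move: xy h wE; set a := `|x - y|; lra.
Qed.

(** * Global solutions of Lipschitz differential equations *)

Section Picard.
Variable R : realType.
Implicit Types (f g h dh F : R -> R) (a b t x y e A C K L M : R).

(** The integral starts from [-1] so that the primitive is differentiable on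
    both sides at [0]. *)
Lemma exists_primitive : exists P : (R -> R) -> R -> R,
  forall f, continuous f ->
    P f 0 = 0 /\ forall t, 0 <= t -> is_derive t 1 (P f) (f t).
Proof.
suff H : forall f, exists F, continuous f ->
    F 0 = 0 /\ forall t, 0 <= t -> is_derive t 1 F (f t).
  by have [P HP] := choice H; exists P.
move=> f; have [cf|ncf] := pselect (continuous f); last by exists f.
pose F x := (\int[lebesgue_measure]_(t in `[(-1 : R), x]) f t)%R.
exists (fun x => F x - F 0) => _; split=> [|t t0]; first by rewrite subrr.
have fint : lebesgue_measure.-integrable `[-1, t + 1] (EFin \o f).
  apply: continuous_compact_integrable; first exact: segment_compact.
  exact: continuous_subspaceT.
have ut : t < t + 1 by rewrite ltrDl.
have lt1 : -1 < t by lra.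
have [dF F'] := continuous_FTC1_closed ut fint lt1 (cf t).
have DF : is_derive t 1 F (f t).
  by apply: DeriveDef; [exact: dF|rewrite -derive1E; exact: F'].
have := is_deriveB DF (is_derive_cst (F 0) t 1).
by rewrite subr0.
Qed.

(** Integrating against the weight [exp (K t)] divides bounds by [K]. With
    [K] twice the Lipschitz constant, each Picard iteration halves the
    weighted distance, on the whole half-line at once. *)
Lemma bielecki_bound h dh C K : 0 < K ->
  h 0 = 0 -> (forall t, 0 <= t -> is_derive t 1 h (dh t)) ->
  (forall t, 0 <= t -> `|dh t| <= C * expR (K * t)) ->
  forall t, 0 <= t -> `|h t| <= C / K * expR (K * t).
Proof.
move=> K0 h0 Dh bdh t t0.
have C0 : 0 <= C.
  by have := le_trans (normr_ge0 _) (bdh 0 (lexx _)); rewrite mulr0 expR0 mulr1.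
have CK : 0 <= C / K by rewrite divr_ge0// ltW.
have De x : is_derive x 1 (fun z => C / K * expR (K * z)) (C * expR (K * x)).
  apply: (is_derive_eq (is_derive_expZ (C / K) K x)).
  by field; rewrite gt_eqF.
rewrite ler_norml; apply/andP; split.
  have := @derive_ge0_le _ (fun z => C / K * expR (K * z) + h z)
    (fun z => C * expR (K * z) + dh z) 0 t t0.
  rewrite h0 mulr0 expR0 => H.
  suff : C / K * 1 + 0 <= C / K * expR (K * t) + h t by lra.
  apply: H => x /andP[x0 _].
    have D1 := De x; have D2 := Dh x x0; exact: is_deriveD.
  by have := bdh x x0; rewrite ler_norml; lra.
have := @derive_ge0_le _ (fun z => C / K * expR (K * z) - h z)
    (fun z => C * expR (K * z) - dh z) 0 t t0.
rewrite h0 mulr0 expR0 => H.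
suff : C / K * 1 - 0 <= C / K * expR (K * t) - h t by lra.
apply: H => x /andP[x0 _].
  have D1 := De x; have D2 := Dh x x0; exact: is_deriveB.
by have := bdh x x0; rewrite ler_norml; lra.
Qed.

Lemma geometric_small A e : 0 < e -> exists n, A / 2 ^+ n < e.
Proof.
move=> e0; exists (Num.Def.archi_bound (A / e)).
rewrite ltr_pdivrMr ?exprn_gt0// mulrC -ltr_pdivrMr//.
exact: upper_nthrootP.
Qed.

(** The sequences [u n -/+ 2 A / 2^n] are nested, and their common bound is
    the limit. *)
Lemma geometric_cauchy (u : nat -> R) A :
  (forall n, `|u n.+1 - u n| <= A / 2 ^+ n) ->
  exists l, forall n, `|u n - l| <= 2 * A / 2 ^+ n.
Proof.
move=> uA.
have pow2 n : 2 * A / 2 ^+ n.+1 = A / 2 ^+ n :> R.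
  by rewrite exprS; field; rewrite expf_neq0.
have pow2' n : 2 * A / 2 ^+ n = A / 2 ^+ n + A / 2 ^+ n by ring.
pose v n := u n - 2 * A / 2 ^+ n.
pose w n := u n + 2 * A / 2 ^+ n.
have A0 n : 0 <= A / 2 ^+ n by apply: le_trans (uA n); exact: normr_ge0.
have vS : {homo v : n m / (n <= m)%N >-> n <= m}.
  apply: homo_leq => // [x y z|n]; first exact: le_trans.
  by rewrite /v pow2 pow2'; have := uA n; rewrite ler_norml; lra.
have wS : {homo w : n m / (n <= m)%N >-> m <= n}.
  apply: homo_leq => // [x y z|n]; first by move=> /[swap]; exact: le_trans.
  by rewrite /w pow2 pow2'; have := uA n; rewrite ler_norml; lra.
have vw n m : v n <= w m.
  apply: (@le_trans _ _ (v (maxn n m))); first by rewrite vS// leq_maxl.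
  apply: (@le_trans _ _ (w (maxn n m))); last by rewrite wS// leq_maxr.
  by rewrite /v /w pow2'; have := A0 (maxn n m); lra.
have hS : has_sup (range v).
  by split; [exists (v 0%N), 0%N|exists (w 0%N) => _ [n _ <-]].
exists (sup (range v)) => n.
have h1 : v n <= sup (range v) by apply: sup_upper_bound => //; exists n.
have h2 : sup (range v) <= w n.
  by apply: sup_le_ub => [|_ [m _ <-]//]; case: hS.
by rewrite ler_norml; move: h1 h2; rewrite /v /w; lra.
Qed.

Lemma lipschitz_comp_continuous (I : finType) (G : (I -> R) -> R) L
    (y : I -> R -> R) : 0 < L ->
  (forall (x z : I -> R) M, (forall j, `|x j - z j| <= M) ->
    `|G x - G z| <= L * M) ->
  (forall j, continuous (y j)) -> continuous (fun t => G (y^~ t)).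
Proof.
move=> L0 GL cy t; apply/cvgrPdist_le => e e0.
have : \forall s \near t, forall j, `|y j t - y j s| <= e / L.
  apply: (@filter_forall _ _
    (fun j s => `|y j t - y j s| <= e / L) (nbhs t)) => j.
  have /cvgrPdist_le := cy j t; apply.
  by rewrite divr_gt0.
apply: filterS => s Hs.
have := GL (y^~ t) (y^~ s) (e / L) Hs.
by rewrite mulrCA divff ?mulr1// gt_eqF.
Qed.

(** The convergence is uniform on bounded sets, where [B] is bounded. *)
Lemma uniform_limit_continuous_loc (u : nat -> R -> R) (l B : R -> R) :
  (forall x y, `|x| <= y -> B x <= B y) ->
  (forall n, continuous (u n)) ->
  (forall n t, `|u n t - l t| <= B t / 2 ^+ n) -> continuous l.
Proof.
move=> Bmono cu ul t; apply/cvgrPdist_lt => e e0.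
have [n Hn] := geometric_small (B (`|t| + 1)) (divr_gt0 e0 (ltr0n R 3)).
have /cvgrPdist_lt/(_ _ (divr_gt0 e0 (ltr0n R 3))) H := cu n t.
have H1 : \forall s \near t, `|t - s| < 1 by exact: (nbhsx_ballx t 1 ltr01).
near=> s.
have Hs : `|u n t - u n s| < e / 3%:R by near: s.
have ts : `|t - s| < 1 by near: s.
have Bn x : `|x| <= `|t| + 1 -> `|u n x - l x| < e / 3%:R.
  move=> /Bmono Bx; apply: le_lt_trans (ul n x) _; apply: le_lt_trans Hn.
  by rewrite ler_wpM2r// invr_ge0 exprn_ge0.
have b1 : `|u n t - l t| < e / 3%:R by apply: Bn; rewrite lerDl.
have b2 : `|u n s - l s| < e / 3%:R.
  by apply: Bn; have := lerB_dist s t; rewrite distrC => h; lra.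
rewrite (_ : l t - l s =
  - (u n t - l t) + (u n t - u n s) + (u n s - l s)); last by ring.
apply: le_lt_trans (ler_normD _ _) _.
have := ler_normD (- (u n t - l t)) (u n t - u n s).
rewrite normrN; lra.
Unshelve. all: by end_near. Qed.

(** The Lipschitz bound is for the maximum norm, uniformly in the
    coordinates. Only times [t >= 0] matter; the iterates are made even in
    [t] so that they are continuous on the whole line, as [exists_primitive]
    asks, without any bound at negative times. *)
Theorem picard (I : finType) (G : (I -> R) -> I -> R) L : 0 < L ->
  (forall (x z : I -> R) M i, (forall j, `|x j - z j| <= M) ->
    `|G x i - G z i| <= L * M) ->
  forall x0 : I -> R, exists y : I -> R -> R, (forall i, y i 0 = x0 i) /\
    forall i t, 0 <= t -> is_derive t 1 (y i) (G (y^~ t) i).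
Proof.
move=> L0 GL x0; have [P HP] := exists_primitive.
pose Y := fix Y (n : nat) : I -> R -> R := if n is m.+1 then
   fun i t => x0 i + P (fun s => G ((Y m)^~ s) i) `|t| else fun i _ => x0 i.
have cG (y : I -> R -> R) i :
    (forall j, continuous (y j)) -> continuous (fun t => G (y^~ t) i).
  by apply: (lipschitz_comp_continuous (G := G^~ i) L0) => x z M; exact: GL.
have cPn f : continuous f -> continuous (fun t => P f `|t|).
  move=> /HP[_ Df] t.
  apply: (@continuous_comp _ _ _ (fun s : R => `|s|) (P f)).
    exact: (@norm_continuous _ R^o).
  exact: is_derive_continuous (Df `|t| (normr_ge0 t)).
have cY n i : continuous (Y n i).
  elim: n i => [|n IH] i /=; first exact: cst_continuous.
  move=> t; apply: cvgD; first exact: cvg_cst.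
  by apply: cPn; apply: cG.
have PB f g C : continuous f -> continuous g ->
    (forall t, 0 <= t -> `|f t - g t| <= C * expR (2 * L * t)) ->
    forall t, 0 <= t -> `|P f t - P g t| <= C / (2 * L) * expR (2 * L * t).
  move=> /HP[f0 Df] /HP[g0 Dg] fg t t0.
  apply: (@bielecki_bound (P f - P g) (f - g) C) => //.
  - by rewrite mulr_gt0.
  - by rewrite /= !fctE f0 g0 subrr.
  - by move=> s s0; apply: is_deriveB; [exact: Df|exact: Dg].
pose C := (\sum_i `|G x0 i|) / (2 * L).
have YS n i t : `|Y n.+1 i t - Y n i t| <= C * expR (2 * L * `|t|) / 2 ^+ n.
  elim: n i t => [|n IH] i t.
    rewrite /= [x0 i + _]addrC addrK expr0 divr1.
    have ck : continuous (fun _ : R => G x0 i) by exact: cst_continuous.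
    have [Pk0 Dk] := HP _ ck.
    apply: (@bielecki_bound _ (fun=> G x0 i)); rewrite ?mulr_gt0//.
    move=> s s0; rewrite (bigD1 i)//= -[leLHS]mulr1.
    apply: ler_pM => //; first by rewrite lerDl sumr_ge0.
    by rewrite -expR0 ler_expR !mulr_ge0// ltW.
  rewrite [Y n.+2 i t]/= [Y n.+1 i t]/= opprD addrACA subrr add0r.
  have := PB (fun s => G ((Y n.+1)^~ s) i) (fun s => G ((Y n)^~ s) i)
    (L * (C / 2 ^+ n)) (cG _ _ (cY _)) (cG _ _ (cY _)).
  move=> /(_ _ `|t| (normr_ge0 t)).
  rewrite (_ : L * (C / 2 ^+ n) / (2 * L) * expR (2 * L * `|t|) =
     C * expR (2 * L * `|t|) / 2 ^+ n.+1); last first.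
    by rewrite exprS; field; rewrite expf_neq0//= gt_eqF.
  apply=> s s0; rewrite -mulrA; apply: GL => j.
  by have := IH j s; rewrite [`|s|]ger0_norm// mulrAC.
have [Z HZ] : exists Z : I -> R -> R, forall i t n,
    `|Y n i t - Z i t| <= 2 * (C * expR (2 * L * `|t|)) / 2 ^+ n.
  have H (it : I * R) : exists l, forall n,
      `|Y n it.1 it.2 - l| <= 2 * (C * expR (2 * L * `|it.2|)) / 2 ^+ n.
    by apply: geometric_cauchy => n; exact: YS.
  have [Z HZ] := choice H; exists (fun i t => Z (i, t)) => i t n.
  exact: (HZ (i, t)).
have C0 : 0 <= C by rewrite divr_ge0 ?sumr_ge0// mulr_ge0// ltW.
have cZ i : continuous (Z i).
  apply: (@uniform_limit_continuous_loc (fun n => Y n i) (Z i)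
    (fun t => 2 * (C * expR (2 * L * `|t|)))) => // x z xz.
  rewrite ler_pM2l// ler_wpM2l// ler_expR ler_pM2l ?mulr_gt0//.
  exact: le_trans xz (ler_norm _).
pose y i t := x0 i + P (fun s => G (Z^~ s) i) t.
have yZ i t : 0 <= t -> y i t = Z i t.
  move=> t0; apply/eqP; rewrite -subr_eq0 -normr_le0 leNgt; apply/negP => e0.
  have [n] := geometric_small (2 * (C * expR (2 * L * t))) e0.
  apply/negP; rewrite -leNgt.
  have h1 := HZ i t n.+1.
  have := PB (fun s => G (Z^~ s) i) (fun s => G ((Y n)^~ s) i)
    (L * (2 * C / 2 ^+ n)) (cG _ _ cZ) (cG _ _ (cY _)).
  move=> /(_ _ t t0) h2.
  have {}h2 :
     `|P (fun s => G (Z^~ s) i) t - P (fun s => G ((Y n)^~ s) i) t| <=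
     2 * (C * expR (2 * L * t)) / 2 ^+ n.+1.
    rewrite (_ : _ / _ = L * (2 * C / 2 ^+ n) / (2 * L) * expR (2 * L * t)).
      apply: h2 => s s0; rewrite -mulrA; apply: GL => j.
      by have := HZ j s n; rewrite distrC [`|s|]ger0_norm// mulrA mulrAC.
    by rewrite exprS; field; rewrite expf_neq0//= gt_eqF.
  move: h1; rewrite /= ![`|t|]ger0_norm// => h1.
  rewrite (_ : y i t - Z i t =
    (P (fun s => G (Z^~ s) i) t - P (fun s => G ((Y n)^~ s) i) t)
    + (x0 i + P (fun s => G ((Y n)^~ s) i) t - Z i t)).
    2: by rewrite /y; ring.
  apply: le_trans (ler_normD _ _) _.
  rewrite (_ : 2 * (C * expR (2 * L * t)) / 2 ^+ n =
    2 * (C * expR (2 * L * t)) / 2 ^+ n.+1 +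
    2 * (C * expR (2 * L * t)) / 2 ^+ n.+1).
    exact: lerD.
  by rewrite exprS; field; rewrite expf_neq0.
exists y; split=> [i|i t t0].
  by rewrite /y (HP _ (cG _ _ cZ)).1 addr0.
have -> : y^~ t = Z^~ t by apply/funext => j; exact: yZ.
have DP := (HP _ (cG _ i cZ)).2 t t0.
by have := is_deriveD (is_derive_cst (x0 i) t 1) DP; rewrite add0r.
Qed.

End Picard.

(** * The angle of the triangle in the variables -ln tanh (r / 2) *)

Section Geometry.
Variable R : realType.
Implicit Types (phi p q x y m : R).

(** This is [pi / 2] minus the argument of the complex number [exp x + exp
    (i phi)]. *)
Definition coarg phi x : R := atan ((expR x + cos phi) / sin phi).

Definition dcoarg phi x : R := sin phi / (expR x + expR (- x) + 2 * cos phi).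

(** The denominator times [exp x] is the squared modulus of [exp x + exp (i
    phi)]. *)
Lemma dcoarg_den_gt0 phi x : 0 < phi < pi ->
  0 < expR x + expR (- x) + 2 * cos phi.
Proof.
move=> phib; have s0 := sin_gt0_pi phib.
have e0 := expR_gt0 x; have ee : expR (- x) * expR x = 1.
  by rewrite -expRD addNr expR0.
have cs := cos2Dsin2 phi.
suff : 0 < (expR x + expR (- x) + 2 * cos phi) * expR x by rewrite pmulr_lgt0.
have -> : (expR x + expR (- x) + 2 * cos phi) * expR x =
  (expR x + cos phi) ^+ 2 + sin phi ^+ 2.
  by rewrite 2!mulrDl ee; nra.
by rewrite ltr_wpDl ?sqr_ge0// exprn_gt0.
Qed.

Lemma is_derive_coarg phi x : 0 < phi < pi ->
  is_derive x 1 (coarg phi) (dcoarg phi x).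
Proof.
move=> phib; have s0 := sin_gt0_pi phib.
have d0 := dcoarg_den_gt0 x phib.
pose g := fun x : R => (expR x + cos phi) / sin phi.
have Dg : is_derive x 1 g (expR x / sin phi).
  have -> : g = (sin phi)^-1 \*: (expR + cst (cos phi)).
    by apply/funext => z; rewrite /g mulrC.
  by apply: is_derive_eq; rewrite addr0 mulrC.
apply: (@is_derive_eq _ _ _ (atan \o g) x 1 _ _
  (is_derive1_comp (is_derive1_atan (g x)) Dg)).
rewrite /dcoarg /g.
have e0 := expR_gt0 x; have ee : expR (- x) = (expR x)^-1 by rewrite expRN.
have cs := sin2cos2 phi.
move: d0; rewrite ee => d0.
have h1 : 1 + ((expR x + cos phi) / sin phi) ^+ 2 =
   (expR x + (expR x)^-1 + 2 * cos phi) * expR x / sin phi ^+ 2.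
  rewrite exprMn exprVn cs; field.
  by rewrite -cs expf_neq0 gt_eqF.
rewrite h1; field; rewrite !gt_eqF//=.
rewrite (_ : _ + _ = (expR x + (expR x)^-1 + 2 * cos phi) * expR x) ?mulr_gt0//.
by field; rewrite gt_eqF.
Qed.

Lemma dcoarg_gt0 phi x : 0 < phi < pi -> 0 < dcoarg phi x.
Proof. by move=> h; rewrite divr_gt0 ?sin_gt0_pi ?dcoarg_den_gt0. Qed.

Lemma dcoargN phi x : dcoarg phi (- x) = dcoarg phi x.
Proof. by rewrite /dcoarg opprK (addrC (expR (- x))). Qed.

(** The derivative is [sin phi / (2 cosh x + 2 cos phi)], whose denominator
    grows with the absolute value of [x]. *)
Lemma dcoarg_le phi x y :
  0 < phi < pi -> `|x| <= `|y| -> dcoarg phi y <= dcoarg phi x.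
Proof.
move=> h; wlog y0 : y / 0 <= y.
  move=> H; have [|/ltW y0] := leP 0 y; first exact: H.
  by have := H (- y); rewrite dcoargN normrN oppr_ge0; exact.
rewrite [`|y|]ger0_norm// ler_norml => /andP[xy1 xy2].
rewrite ler_pM2l ?sin_gt0_pi// lef_pV2 ?posrE ?dcoarg_den_gt0// lerD2r.
have e1 : expR (- y) * expR y = 1 by rewrite -expRD addNr expR0.
have e2 : expR (- x) * expR x = 1 by rewrite -expRD addNr expR0.
have := expR_gt0 x; have := expR_gt0 y.
have : expR x <= expR y by rewrite ler_expR.
have : expR (- y) <= expR x by rewrite ler_expR.
have := expR_gt0 (- x); have := expR_gt0 (- y).
move: (expR x) (expR y) (expR (- x)) (expR (- y)) e1 e2.
move=> a b c d bd ac d0 c0 da ab b0 a0.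
(* [b + d - a - c] times [a c = 1] is this product. *)
suff : 0 <= (b - a) * (a - d) * c.
  rewrite (_ : _ * c = b * (c * a) - (d * b) * c - a * (c * a) + d * (c * a)).
    by rewrite bd ac; lra.
  by ring.
by rewrite !mulr_ge0 ?subr_ge0// ltW.
Qed.

Lemma coarg_lt phi x y : 0 < phi < pi -> x < y -> coarg phi x < coarg phi y.
Proof.
move=> h xy; rewrite lt_atan// ltr_pM2r ?invr_gt0 ?sin_gt0_pi//.
by rewrite ltrD2r ltr_expR.
Qed.

Lemma coarg_lipschitz phi x y : 0 < phi < pi ->
  `|coarg phi x - coarg phi y| <= dcoarg phi 0 * `|x - y|.
Proof.
move=> h; wlog xy : x y / x <= y.
  have [xy|/ltW xy] := leP x y; first exact.
  by rewrite distrC (distrC x); exact.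
have /ler0_norm -> : coarg phi x - coarg phi y <= 0.
  by move: xy; rewrite le_eqVlt subr_le0 => /predU1P[->//|/(coarg_lt h)/ltW].
have /ler0_norm -> : x - y <= 0 by rewrite subr_le0.
rewrite !opprB.
have := @derive_ge0_le _ (dcoarg phi 0 \*: id - coarg phi)
   (fun z => dcoarg phi 0 - dcoarg phi z) x y xy.
rewrite /= /GRing.scale/= => H.
suff : dcoarg phi 0 * x - coarg phi x <= dcoarg phi 0 * y - coarg phi y by lra.
apply: H => z zxy; last by rewrite subr_ge0 dcoarg_le// normr0.
have Dp := is_derive_coarg z h.
by apply: is_derive_eq; rewrite /GRing.scale/= mulr1.
Qed.

Lemma coarg_increment phi x m B :
  0 < phi < pi -> 0 <= x -> 0 <= m -> x + m <= B ->
  dcoarg phi B * m <= coarg phi (x + m) - coarg phi x.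
Proof.
move=> h x0 m0 xB.
have := @derive_ge0_le _ (coarg phi - dcoarg phi B \*: id)
   (fun z => dcoarg phi z - dcoarg phi B) x (x + m).
rewrite /= /GRing.scale/= lerDl => /(_ m0) H.
suff : coarg phi x - dcoarg phi B * x <=
  coarg phi (x + m) - dcoarg phi B * (x + m) by lra.
apply: H => z /andP[xz zm]; last first.
  by rewrite subr_ge0 dcoarg_le// !ger0_norm; lra.
have Dp := is_derive_coarg z h.
by apply: is_derive_eq; rewrite /GRing.scale/= mulr1.
Qed.

(** The angle of the triangle is the argument of [cosh q + cosh (p + i
    phi)]. This sum is the product of twice [cosh ((q + p + i phi) / 2)] and
    [cosh ((q - p - i phi) / 2)], whose argument is therefore the difference
    of the values of one function at [q + p] and [q - p]. *)
Definition angle phi p q : R := coarg phi (q + p) - coarg phi (q - p).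

Lemma angle_gt0 phi p q : 0 < phi < pi -> 0 < p -> 0 < angle phi p q.
Proof. by move=> h p0; rewrite subr_gt0 coarg_lt//; lra. Qed.

Lemma angle_ltpi phi p q : angle phi p q < pi.
Proof.
rewrite /angle /coarg.
have := atan_ltpi2 ((expR (q + p) + cos phi) / sin phi).
have := atan_gtNpi2 ((expR (q - p) + cos phi) / sin phi).
lra.
Qed.

Lemma angle_lipschitz phi p q p' q' : 0 < phi < pi ->
  `|angle phi p q - angle phi p' q'| <=
    2 * dcoarg phi 0 * (`|p - p'| + `|q - q'|).
Proof.
move=> h.
rewrite (_ : angle phi p q - _ = (coarg phi (q + p) - coarg phi (q' + p')) -
   (coarg phi (q - p) - coarg phi (q' - p'))); last by rewrite /angle; ring.
apply: (le_trans (ler_normB _ _)).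
rewrite (_ : 2 * dcoarg phi 0 * _ = dcoarg phi 0 * (`|p - p'| + `|q - q'|) +
  dcoarg phi 0 * (`|p - p'| + `|q - q'|)); last by ring.
have d0 := ltW (dcoarg_gt0 0 h).
apply: lerD; apply: (le_trans (coarg_lipschitz _ _ h)); apply: ler_wpM2l => //.
  by rewrite (_ : _ - _ = (p - p') + (q - q')) ?ler_normD//; ring.
rewrite (_ : _ - _ = (q - q') - (p - p')); last by ring.
by rewrite (addrC `|p - p'|) ler_normB.
Qed.

Lemma angle_le_lin phi p q : 0 < phi < pi -> 0 <= p ->
  angle phi p q <= 2 * dcoarg phi 0 * p.
Proof.
move=> h p0; apply: le_trans (ler_norm _) _.
apply: (le_trans (coarg_lipschitz _ _ h)).
rewrite (_ : _ - _ = 2 * p) ?ger0_norm; [|lra|ring].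
by rewrite mulrCA mulrA.
Qed.

(** The derivative in [q] is [dcoarg (q + p) - dcoarg (q - p)], which is
    nonpositive because [q + p] is farther from [0] than [q - p]. *)
Lemma angle_le_r phi p q q' : 0 < phi < pi -> 0 <= p -> 0 <= q -> q <= q' ->
  angle phi p q' <= angle phi p q.
Proof.
move=> h p0 q0 qq.
have := @derive_ge0_le _ (fun z => coarg phi (z - p) - coarg phi (z + p))
   (fun z => dcoarg phi (z - p) - dcoarg phi (z + p)) q q' qq.
rewrite /angle => H.
suff : coarg phi (q - p) - coarg phi (q + p) <=
  coarg phi (q' - p) - coarg phi (q' + p) by lra.
apply: H => z /andP[xz zm]; last first.
  rewrite subr_ge0 dcoarg_le// [leRHS]ger0_norm; last lra.
  by rewrite ler_norml; lra.
have D k : is_derive z 1 (fun w => coarg phi (w + k)) (dcoarg phi (z + k)).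
  have := @is_derive1_comp R (coarg phi) (shift k) z _ _
    (is_derive_coarg (z + k) h) (is_derive_shift z 1 k).
  by rewrite mulr1.
by apply: is_deriveB.
Qed.

(** The difference [q - p] does not change, so that only the increasing term
    [coarg (q + p)] varies. *)
Lemma angle_diag phi p q m B : 0 < phi < pi -> 0 <= p -> 0 <= q -> 0 <= m ->
  p + q + 2 * m <= B ->
  dcoarg phi B * (2 * m) <= angle phi (p + m) (q + m) - angle phi p q.
Proof.
move=> h p0 q0 m0 B0; rewrite /angle.
rewrite (_ : q + m - (p + m) = q - p); last by ring.
rewrite (_ : q + m + (p + m) = (q + p) + 2 * m); last by ring.
have : dcoarg phi B * (2 * m) <= coarg phi (q + p + 2 * m) - coarg phi (q + p).
  by apply: coarg_increment => //; lra.
by lra.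
Qed.

Lemma coarg0 phi : 0 < phi < pi -> coarg phi 0 = (pi - phi) / 2.
Proof.
move=> h; rewrite /coarg expR0.
have [h1 h2] := andP h.
rewrite -[RHS]tanK; last by rewrite in_itv/=; lra.
congr atan; rewrite mulrBl /tan -[pi / 2 - _]opprB sinN cosN.
rewrite sinBpihalf cosBpihalf opprK.
have s0 : sin (phi / 2) != 0 by rewrite gt_eqF// sin_gt0_pihalf//; lra.
have c0 : cos (phi / 2) != 0 by rewrite gt_eqF// cos_gt0_pihalf//; lra.
have -> : phi = (phi / 2) *+ 2 by rewrite -mulr_natr; field.
rewrite sin_mulr2n cos_mulr2n -[in RHS]mulr_natr mulfK//.
by field; rewrite s0.
Qed.

Lemma angle_diag_lt phi p : 0 < phi < pi -> angle phi p p < phi / 2.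
Proof.
move=> h; rewrite /angle subrr coarg0//.
have := atan_ltpi2 ((expR (p + p) + cos phi) / sin phi).
rewrite /coarg; lra.
Qed.

Lemma angle_diag_cvg phi : 0 < phi < pi ->
  angle phi p p @[p --> +oo] --> phi / 2.
Proof.
move=> h; rewrite /angle.
have -> : phi / 2 = pi / 2 - (pi - phi) / 2 by field.
under eq_fun do rewrite subrr coarg0//.
apply: cvgB; last exact: cvg_cst.
apply: (@cvg_comp _ _ _ _ atan); last exact: cvgy_atan.
apply/cvgryPge => A; near=> p.
rewrite ler_pdivlMr ?sin_gt0_pi//.
have -> : A * sin phi = (A * sin phi - cos phi) + cos phi by rewrite subrK.
rewrite lerD2r (le_trans _ (expR_ge1Dx _))//.
near: p; exists (`|A * sin phi - cos phi|); split; first by rewrite num_real.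
move=> p hp; have := ler_norm (A * sin phi - cos phi).
have := normr_ge0 (A * sin phi - cos phi).
move: hp; set u := `|_|; lra.
Unshelve. all: by end_near. Qed.

End Geometry.

(** * The change of variable r = -ln tanh (p / 2) *)

Section Radius.
Variable R : realType.
Implicit Types (phi p q x y m : R).

Lemma expN_itv x : 0 < x -> 0 < expR (- x) < 1.
Proof. by move=> x0; rewrite expR_gt0 expR_lt1 oppr_lt0. Qed.

(** [tau x] is [- ln (tanh (x / 2))]; it is characterised by [sinh x * sinh
    (tau x) = 1]. *)
Definition tau x : R := ln ((1 + expR (- x)) / (1 - expR (- x))).

Lemma expR_tau x : 0 < x -> expR (tau x) = (1 + expR (- x)) / (1 - expR (- x)).
Proof.
by move=> /expN_itv/andP[e0 e1]; rewrite lnK// posrE divr_gt0; lra.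
Qed.

Lemma expR_Ntau x : 0 < x ->
  expR (- tau x) = (1 - expR (- x)) / (1 + expR (- x)).
Proof. by move=> x0; rewrite expRN expR_tau// invf_div. Qed.

Lemma tau_gt0 x : 0 < x -> 0 < tau x.
Proof.
move=> /expN_itv/andP[e0 e1]; apply: ln_gt0.
by rewrite ltr_pdivlMr ?mul1r; lra.
Qed.

Lemma tauK x : 0 < x -> tau (tau x) = x.
Proof.
move=> x0; have /andP[e0 e1] := expN_itv x0.
rewrite {1}/tau expR_Ntau// [X in ln X](_ : _ = expR x) ?expRK//.
rewrite -[in RHS](opprK x) [in RHS]expRN; move: (expR (- x)) e0 e1 => e e0 e1.
by field; rewrite !gt_eqF//=; lra.
Qed.

Lemma sinh_tau x : 0 < x ->
  sinh (tau x) = 2 * expR (- x) / (1 - expR (- x) ^+ 2).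
Proof.
move=> x0; have /andP[e0 e1] := expN_itv x0.
rewrite /sinh expR_Ntau// expR_tau//.
move: (expR (- x)) e0 e1 => e e0 e1.
by field; rewrite !gt_eqF//=; nra.
Qed.

Lemma cosh_tau x : 0 < x ->
  cosh (tau x) = (1 + expR (- x) ^+ 2) / (1 - expR (- x) ^+ 2).
Proof.
move=> x0; have /andP[e0 e1] := expN_itv x0.
rewrite /cosh expR_Ntau// expR_tau//.
move: (expR (- x)) e0 e1 => e e0 e1.
by field; rewrite !gt_eqF//=; nra.
Qed.

Lemma sinh_gt0 x : 0 < x -> 0 < sinh x.
Proof. by move=> x0; rewrite divr_gt0// subr_gt0 ltr_expR; lra. Qed.

Lemma sinh_tauV x : 0 < x -> sinh (tau x) = (sinh x)^-1.
Proof.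
move=> x0; have /andP[e0 e1] := expN_itv x0.
rewrite sinh_tau// /sinh -[X in _ = ((expR X - _) / _)^-1](opprK x).
rewrite [X in _ = ((X - _) / _)^-1]expRN.
move: (expR (- x)) e0 e1 => e e0 e1.
by field; rewrite !gt_eqF//=; nra.
Qed.

Lemma is_derive_tau x : 0 < x -> is_derive x 1 tau (- (sinh x)^-1).
Proof.
move=> x0; have /andP[e0 e1] := expN_itv x0.
pose E := fun z : R => expR (- z).
have DE : is_derive x 1 E (- expR (- x)).
  rewrite -mulrN1; exact: (@is_derive1_comp R expR -%R).
have E1 : 1 - E x != 0 by rewrite gt_eqF// /E; lra.
have DV : is_derive x 1 (fun z => (1 - E z)^-1)
    (- (1 - E x) ^- 2 *: (0 - (- expR (- x)))).
  exact: (is_deriveV (f := cst 1 - E)).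
have DM : is_derive x 1 (fun z => (1 + E z) * (1 - E z)^-1)
    ((1 + E x) *: (- (1 - E x) ^- 2 *: (0 - (- expR (- x)))) +
     (1 - E x)^-1 *: (0 + - expR (- x))).
  exact: (is_deriveM (f := cst 1 + E) (g := (fun z => (1 - E z)^-1))).
have q0 : 0 < (1 + E x) * (1 - E x)^-1 by rewrite divr_gt0 /E//; lra.
have D : is_derive x 1 tau _ := @is_derive1_comp R (@ln R)
  (fun z => (1 + E z) * (1 - E z)^-1) x _ _ (is_derive1_ln q0) DM.
apply: (is_derive_eq D).
rewrite /E -sinh_tauV// sinh_tau// /GRing.scale/=.
move: (expR (- x)) e0 e1 => e e0 e1.
by field; rewrite !gt_eqF//=; nra.
Qed.

Lemma cosh_ge1 x : 1 <= cosh x.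
Proof.
have e0 := expR_gt0 x; have e1 : expR (- x) * expR x = 1.
  by rewrite -expRD addNr expR0.
have : 0 <= (expR x - 1) ^+ 2 * expR (- x).
  by rewrite mulr_ge0 ?sqr_ge0 ?expR_ge0.
by rewrite /cosh ler_pdivlMr//; nra.
Qed.

Lemma cosh2_sinh2 x : cosh x ^+ 2 - sinh x ^+ 2 = 1.
Proof.
have e1 : expR (- x) * expR x = 1 by rewrite -expRD addNr expR0.
by rewrite -[RHS]e1 /cosh /sinh; field.
Qed.

Lemma expR_arcosh x : 1 <= x ->
  expR (arcosh x) = x + Num.sqrt (x ^+ 2 - 1) /\
  expR (- arcosh x) = x - Num.sqrt (x ^+ 2 - 1).
Proof.
move=> x1; have s0 := sqrtr_ge0 (x ^+ 2 - 1).
have s2 : Num.sqrt (x ^+ 2 - 1) ^+ 2 = x ^+ 2 - 1 by rewrite sqr_sqrtr//; nra.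
have e : expR (arcosh x) = x + Num.sqrt (x ^+ 2 - 1).
  by rewrite lnK// posrE; lra.
split=> //; rewrite expRN e; apply: (@mulIf _ (x + Num.sqrt (x ^+ 2 - 1))).
  by rewrite gt_eqF//; lra.
by rewrite mulVf ?gt_eqF//; [nra|lra].
Qed.

Lemma cosh_arcosh x : 1 <= x -> cosh (arcosh x) = x.
Proof. by move=> /expR_arcosh[e1 e2]; rewrite /cosh e1 e2; field. Qed.

Lemma sinh_arcosh x : 1 <= x -> sinh (arcosh x) = Num.sqrt (x ^+ 2 - 1).
Proof. by move=> /expR_arcosh[e1 e2]; rewrite /sinh e1 e2; field. Qed.

Lemma sin_atan x : sin (atan x) = x * cos (atan x).
Proof.
rewrite -[X in X * _]atanK /tan divfK// gt_eqF// cos_gt0_pihalf//.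
by rewrite atan_gtNpi2 atan_ltpi2.
Qed.

(** In a right triangle with legs [u] and [v], the angle is determined by
    its cotangent, which involves no square root. *)
Lemma acos_cotangent (g u v : R) : 0 < g < pi -> 0 < v ->
  cos g * v = sin g * u -> acos (u / Num.sqrt (u ^+ 2 + v ^+ 2)) = g.
Proof.
move=> g0 v0 e; have s0 := sin_gt0_pi g0.
have sq : Num.sqrt (u ^+ 2 + v ^+ 2) = v / sin g.
  have -> : u ^+ 2 + v ^+ 2 = (v / sin g) ^+ 2.
    have -> : u = cos g * v / sin g by rewrite e mulrAC divff ?mul1r// gt_eqF.
    have := cos2Dsin2 g; set c := cos g; set s := sin g => cs.
    rewrite !exprMn exprVn -[v ^+ 2 in X in _ + X](mulfK (x := s ^+ 2));
      last by rewrite expf_neq0 ?gt_eqF.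
    by rewrite -mulrDl -[in RHS](mulr1 (v ^+ 2)) -cs mulrDr (mulrC (c ^+ 2)).
  by rewrite sqrtr_sqr ger0_norm// divr_ge0// ltW.
rewrite sq (_ : u / _ = cos g) ?cosK ?in_itv/=; first by [].
  by lra.
by rewrite invf_div mulrA (mulrC u) -e mulfK// gt_eqF.
Qed.

(** The four-part formula of hyperbolic trigonometry, [cot g * sinh b * sin
    phi = sinh a * cosh b + cosh a * sinh b * cos phi], as a
    characterisation of the angle at the center of the circle of radius [a]. *)
Lemma theta_cotangent phi a b g : 0 < phi < pi -> 0 < a -> 0 < b ->
  0 < g < pi ->
  cos g * (sinh b * sin phi) =
    sin g * (sinh a * cosh b + cosh a * sinh b * cos phi) ->
  theta phi a b = g.
Proof.
move=> h /sinh_gt0 a0 /sinh_gt0 b0 gpi cotg; have s0 := sin_gt0_pi h.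
rewrite /theta /hyp_angle /center_dist.
have ca := cosh2_sinh2 a; have cb := cosh2_sinh2 b.
have a1 := cosh_ge1 a; have b1 := cosh_ge1 b.
have cg := cos_geN1 phi; have sc := sin2cos2 phi.
move: (cosh a) (sinh a) (cosh b) (sinh b) (cos phi) (sin phi) ca cb a1 b1 cg sc
  a0 b0 s0 cotg => A a' B b' c s ca cb A1 B1 c1 sc a0 b0 s0 cotg {h}.
have X1 : 1 <= A * B + a' * b' * c.
  have : 0 <= a' * b' * (c + 1).
    by apply: mulr_ge0; [rewrite mulr_ge0 ?ltW|lra].
  suff : 1 + a' * b' <= A * B by lra.
  rewrite -(@ler_pXn2r _ 2) ?nnegrE//; last 2 first.
  - by rewrite addr_ge0 ?mulr_ge0 ?ltW.
  - by rewrite mulr_ge0//; lra.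
  have ea : A ^+ 2 = 1 + a' ^+ 2 by lra.
  have eb : B ^+ 2 = 1 + b' ^+ 2 by lra.
  rewrite exprMn ea eb -subr_ge0.
  by rewrite [leRHS](_ : _ = (a' - b') ^+ 2) ?sqr_ge0//; ring.
rewrite cosh_arcosh// sinh_arcosh//.
set X := A * B + _; set U := a' * B + A * b' * c in cotg *.
have sa : A ^+ 2 = 1 + a' ^+ 2 by lra.
have sb : B ^+ 2 = 1 + b' ^+ 2 by lra.
have -> : X ^+ 2 - 1 = U ^+ 2 + (b' * s) ^+ 2.
  rewrite /X /U exprMn sc.
  by ring: sa sb.
have -> : (A * X - B) / (a' * Num.sqrt (U ^+ 2 + (b' * s) ^+ 2)) =
    U / Num.sqrt (U ^+ 2 + (b' * s) ^+ 2).
  rewrite invfM mulrA; congr (_ / _).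
  apply: (@mulIf _ a'); first by rewrite gt_eqF.
  rewrite divfK ?gt_eqF// /X /U.
  by ring: sa.
by apply: acos_cotangent => //; rewrite mulr_gt0.
Qed.

(** Both members of the four-part formula are rational functions of [exp (-
    p)], [exp (- q)] and the cosine and sine of [phi]. *)
Lemma theta_tau phi p q : 0 < phi < pi -> 0 < p -> 0 < q ->
  theta phi (tau p) (tau q) = angle phi p q.
Proof.
move=> h p0 q0; have s0 := sin_gt0_pi h.
have /andP[e0 e1] := expN_itv p0; have /andP[f0 f1] := expN_itv q0.
apply: theta_cotangent; rewrite ?tau_gt0 ?angle_gt0 ?angle_ltpi//.
rewrite /angle /coarg; set A := _ / _; set B := (_ + _) / _.
rewrite cosB sinB !sin_atan.
set k := cos (atan A); set l := cos (atan B).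
set V := sinh (tau q) * sin phi.
set U := sinh (tau p) * cosh (tau q) + cosh (tau p) * sinh (tau q) * cos phi.
suff e : (1 + A * B) * V = (A - B) * U.
  rewrite (_ : _ + _ = k * l * (1 + A * B)); last by ring.
  by rewrite -mulrA e; ring.
rewrite /V /U /A /B !sinh_tau// !cosh_tau//.
have -> : expR (q + p) = (expR (- p) * expR (- q))^-1.
  by rewrite -expRD -expRN; congr expR; ring.
have -> : expR (q - p) = expR (- p) / expR (- q).
  by rewrite -expRN opprK -expRD; congr expR; ring.
have cs : cos phi ^+ 2 = 1 - sin phi ^+ 2 by rewrite sin2cos2; ring.
clear k l V U A B.
move: (expR (- p)) (expR (- q)) e0 e1 f0 f1 => e f e0 e1 f0 f1.
move: (cos phi) (sin phi) cs s0 => c s cs s0.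
field: cs.
by rewrite !gt_eqF//=; nra.
Qed.

Lemma tau_lipschitz (e x y : R) : 0 < e -> e <= x -> e <= y ->
  `|tau x - tau y| <= (sinh e)^-1 * `|x - y|.
Proof.
move=> e0; wlog xy : x y / x <= y => [H ex ey|ex ey].
  have [xy|/ltW xy] := leP x y; first exact: H.
  by rewrite distrC (distrC x); exact: H.
have Dtau (z : R) : x <= z <= y -> is_derive z 1 (tau) (- (sinh z)^-1).
  by move=> zxy; apply: is_derive_tau; lra.
have sz (z : R) : x <= z <= y -> 0 < (sinh z)^-1 <= (sinh e)^-1.
  move=> zxy; have z0 : 0 < z by lra.
  rewrite invr_gt0 sinh_gt0//= lef_pV2 ?posrE ?sinh_gt0//.
  rewrite /sinh ler_pM2r ?invr_gt0// lerB// ler_expR; lra.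
have h1 : - tau x <= - tau y.
  apply: (@derive_ge0_le _ (- tau) (fun z => (sinh z)^-1)) => // z zxy.
    by have D1 := Dtau z zxy; apply: is_derive_eq; rewrite opprK.
  by have := sz z zxy; lra.
have h2 : tau x + (sinh e)^-1 * x <= tau y + (sinh e)^-1 * y.
  have := @derive_ge0_le _ (tau + (sinh e)^-1 \*: id)
    (fun z => - (sinh z)^-1 + (sinh e)^-1) x y xy.
  rewrite /= /GRing.scale/=; apply=> z zxy.
    have D1 := Dtau z zxy; apply: is_derive_eq.
    by rewrite /GRing.scale/= mulr1.
  by have := sz z zxy; lra.
rewrite distrC [`|x - y|]distrC ler0_norm ?ger0_norm; lra.
Qed.

(** Large [p] means exponentially small radius. *)
Lemma tau_le_exp (a x : R) : 0 < a -> a <= x ->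
  tau x <= 2 / (1 - expR (- a)) * expR (- x).
Proof.
move=> a0 ax; have /andP[e0 e1] := expN_itv a0.
have /andP[f0 f1] := expN_itv (lt_le_trans a0 ax).
have fe : expR (- x) <= expR (- a) by rewrite ler_expR lerN2.
rewrite /tau; have -> : (1 + expR (- x)) / (1 - expR (- x)) =
    1 + 2 * expR (- x) / (1 - expR (- x)).
  by field; rewrite gt_eqF//; lra.
apply: le_trans (le_ln1Dx _) _.
  by apply: lt_le_trans (_ : 0 <= _); [lra|rewrite divr_ge0//; lra].
by rewrite mulrAC ler_pM2r// ler_pM2l// lef_pV2 ?posrE; lra.
Qed.

End Radius.

(** * The flow in the new variables *)

Section System.
Variables (R : realType) (N : nat) (D : cellular_decomposition N).
Variable Phi : edge D -> R.
Hypothesis Phi_bounds : forall e, 0 < Phi e < pi.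
Implicit Types (p q u v kap : 'I_N -> R) (i j : 'I_N) (d : dart D).

Definition angle_sum p i : R :=
  \sum_(d : dart D | org d == i)
    angle (Phi (edge_of d)) (p i) (p (org (opp D d))).

(** The curvature minus the prescribed one, when [kap i] is [2 pi - Kbar_i]
    and [p] is the vector of the [- ln tanh (r_i / 2)]. *)
Definition drift kap p i : R := kap i - 2 * angle_sum p i.

Lemma angle_sum_lipschitz : exists2 L : R, 0 < L & forall p q (M : R) i,
  (forall j, `|p j - q j| <= M) -> `|angle_sum p i - angle_sum q i| <= L * M.
Proof.
pose L := 1 + \sum_(d : dart D) 4 * dcoarg (Phi (edge_of d)) 0.
have d0 d : 0 <= 4 * dcoarg (Phi (edge_of d)) 0.
  by rewrite mulr_ge0// ltW// dcoarg_gt0.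
have L0 : 0 < L by rewrite ltr_wpDr// sumr_ge0.
exists L => // p q M i pq; have M0 : 0 <= M := le_trans (normr_ge0 _) (pq i).
rewrite -sumrB; apply: (le_trans (ler_norm_sum _ _ _)).
apply: (@le_trans _ _
   (\sum_(d | org d == i) 4 * dcoarg (Phi (edge_of d)) 0 * M)).
  apply: ler_sum => d _.
  apply: le_trans (angle_lipschitz _ _ _ _ (Phi_bounds _)) _.
  have := pq i; have := pq (org (opp D d)) => h1 h2.
  rewrite (_ : 4 * _ * M = 2 * dcoarg (Phi (edge_of d)) 0 * (M + M)).
    2: by ring.
  by rewrite ler_wpM2l ?lerD// mulr_ge0// ltW// dcoarg_gt0.
rewrite -mulr_suml ler_wpM2r// /L big_mkcond/=.
apply: ler_wpDl => //; apply: ler_sum => d _; by case: ifP.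
Qed.

Lemma drift_lipschitz kap : exists2 L : R, 0 < L & forall p q (M : R) i,
  (forall j, `|p j - q j| <= M) -> `|drift kap p i - drift kap q i| <= L * M.
Proof.
have [L L0 HL] := angle_sum_lipschitz.
exists (2 * L); first by rewrite mulr_gt0.
move=> p q M i pq; rewrite /drift.
rewrite (_ : _ - _ = 2 * (angle_sum q i - angle_sum p i)); last by ring.
by rewrite normrM ger0_norm// distrC -mulrA ler_wpM2l// HL.
Qed.

Lemma angle_sum_le_lin p i : 0 <= p i ->
  angle_sum p i <= (\sum_d 2 * dcoarg (Phi (edge_of d)) 0) * p i.
Proof.
move=> p0; apply: (@le_trans _ _
   ((\sum_(d | org d == i) 2 * dcoarg (Phi (edge_of d)) 0) * p i)).
  by rewrite mulr_suml; apply: ler_sum => d _; exact: angle_le_lin.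
rewrite ler_wpM2r// big_mkcond/=; apply: ler_sum => d _; case: ifP => // _.
by rewrite mulr_ge0// ltW// dcoarg_gt0.
Qed.

(** The angles at [i] are bounded by a multiple of [u i], whatever the other
    values are: below some level, every coordinate is pushed upwards. *)
Lemma exists_barrier kap p : (forall i, 0 < kap i) -> (forall i, 0 < p i) ->
  exists e : R, [/\ 0 < e, forall i, e < p i &
    forall u i, u i = e -> 0 < drift kap u i].
Proof.
move=> k0 p0.
pose S := \sum_(d : dart D) 2 * dcoarg (Phi (edge_of d)) 0.
have S0 : 0 <= S.
  by apply: sumr_ge0 => d _; rewrite mulr_ge0// ltW// dcoarg_gt0.
have [e e0 He] := @exists_below R _
   (fun i => Num.min (p i) (kap i / (2 * S + 1)))
   (fun i => ltac:(rewrite lt_min p0 divr_gt0//; lra)).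
exists e; split=> // [i|u i ui].
  by have := He i; rewrite lt_min => /andP[].
have := He i; rewrite lt_min => /andP[_]; rewrite ltr_pdivlMr; last by lra.
rewrite /drift; have : angle_sum u i <= S * e.
  by rewrite -ui; apply: angle_sum_le_lin; rewrite ui ltW.
nra.
Qed.

(** The bound [u j <= v j + m] makes the angles at [i] for [u] at least
    those for [v] shifted by [m] in all coordinates, and the shift moves
    along diagonals. *)
Lemma angle_sum_increment u v i (m B : R) :
  (forall j, 0 <= u j) -> (forall j, 0 <= v j) -> 0 <= m ->
  u i = v i + m -> (forall j, u j <= v j + m) ->
  (forall j, v i + v j + 2 * m <= B) ->
  \sum_(d : dart D | org d == i) dcoarg (Phi (edge_of d)) B * (2 * m) <=
    angle_sum u i - angle_sum v i.
Proof.
move=> u0 v0 m0 ui uj vB; rewrite -sumrB; apply: ler_sum => d _.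
set j := org (opp D d); have Pb := Phi_bounds (edge_of d).
apply: le_trans (angle_diag Pb (v0 i) (v0 j) m0 (vB j)) _.
by rewrite lerD2r -ui angle_le_r.
Qed.

Lemma angle_sum_le u v i (m : R) :
  (forall j, 0 <= u j) -> (forall j, 0 <= v j) -> 0 <= m ->
  u i = v i + m -> (forall j, u j <= v j + m) -> angle_sum v i <= angle_sum u i.
Proof.
move=> u0 v0 m0 ui uj; rewrite -subr_ge0.
apply: le_trans (@angle_sum_increment u v i m (v i + \sum_j v j + 2 * m)
  u0 v0 m0 ui uj _).
  apply: sumr_ge0 => d _; apply: mulr_ge0; last by rewrite mulr_ge0.
  by rewrite ltW// dcoarg_gt0.
move=> j; rewrite lerD2r lerD2l (bigD1 j)//= lerDl sumr_ge0//.
Qed.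

(** At a minimum of [p], replacing every neighbour by [p i] increases the
    angles, and makes them diagonal. *)
Lemma angle_sum_min p i : 0 <= p i -> (forall j, p i <= p j) ->
  angle_sum p i <= character Phi i / 2.
Proof.
move=> p0 pm; rewrite mulr_suml; apply: ler_sum => d _.
apply: le_trans (angle_le_r _ _ _ (pm _)) _ => //.
by rewrite ltW// angle_diag_lt.
Qed.

Lemma angle_sum_min_lt p i d0 : org d0 = i -> 0 <= p i ->
  (forall j, p i <= p j) -> angle_sum p i < character Phi i / 2.
Proof.
move=> di p0 pm; rewrite mulr_suml.
rewrite /angle_sum (bigD1 d0) ?di ?eqxx//= [ltRHS](bigD1 d0) ?di ?eqxx//=.
apply: ltr_leD.
  apply: le_lt_trans (angle_le_r _ _ _ (pm _)) _ => //.
  exact: angle_diag_lt.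
apply: ler_sum => d _; apply: le_trans (angle_le_r _ _ _ (pm _)) _ => //.
by rewrite ltW// angle_diag_lt.
Qed.

(** Right continuity at [0] and two-sided derivatives at positive times,
    which is all that the maximum principle uses. *)
Definition solution kap (p : 'I_N -> R -> R) (b : R) : Prop :=
  [/\ forall i, p i x @[x --> 0^'+] --> p i 0,
      forall i t, 0 <= t <= b -> 0 < p i t &
      forall i t, 0 < t <= b -> is_derive t 1 (p i) (drift kap (p^~ t) i)].

(** A coordinate that comes down to [e] is pushed upwards. For positive [e]
    this gives the positivity of the solutions provided by Picard's theorem. *)
Lemma solution_gt kap (p : 'I_N -> R -> R) (b e : R) :
  (forall i, p i x @[x --> 0^'+] --> p i 0) ->
  (forall i t, 0 < t <= b -> is_derive t 1 (p i) (drift kap (p^~ t) i)) ->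
  (forall i, e < p i 0) ->
  (forall u i, u i = e -> 0 < drift kap u i) ->
  forall i t, 0 <= t <= b -> e < p i t.
Proof.
move=> cp Dp ep He i t tb; rewrite -subr_lt0.
apply: (@max_principle _ _ (fun i t => e - p i t)
  (fun i t => 0 - drift kap (p^~ t) i) b)
  => // {i t tb} [i|i|i t tb|i t tb w0 _].
- by rewrite subr_lt0.
- by apply: cvgB; [exact: cvg_cst|exact: cp].
- by have D1 := Dp i t tb; exact: is_deriveB.
by rewrite sub0r oppr_lt0; apply: He; lra.
Qed.

(** The maximum principle for the functions [p i - q i - g] and [q i - p i -
    g] together; [u] and [v] stand for the two solutions in either order. *)
Lemma comparison kap (p q : 'I_N -> R -> R) (g dg : R -> R) b :
  solution kap p b -> solution kap q b ->
  g x @[x --> 0^'+] --> g 0 ->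
  (forall t, 0 < t <= b -> is_derive t 1 g (dg t)) ->
  (forall i, `|p i 0 - q i 0| < g 0) ->
  (forall i t u v, 0 < t <= b ->
     (u = p^~ t /\ v = q^~ t) \/ (u = q^~ t /\ v = p^~ t) ->
     u i = v i + g t -> (forall j, u j <= v j + g t) ->
     (forall j, v j <= u j + g t) ->
     drift kap u i - drift kap v i < dg t) ->
  forall i t, 0 <= t <= b -> `|p i t - q i t| < g t.
Proof.
move=> [cp p0 Dp] [cq q0 Dq] cg Dg g0 Hd i t tb.
(* Both signs at once: the index set is ['I_N * bool]. *)
pose u (s : bool) : 'I_N -> R -> R := if s then p else q.
have H (x : 'I_N * bool) : u x.2 x.1 t - u (~~ x.2) x.1 t - g t < 0.
  apply: (@max_principle _ _ (fun x t => u x.2 x.1 t - u (~~ x.2) x.1 t - g t)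
    (fun x t => drift kap ((u x.2)^~ t) x.1 -
      drift kap ((u (~~ x.2))^~ t) x.1 - dg t) b)
    => // {i t tb x} [[i s]|[i s]|[i s] t tb|[i s] t tb /= w0 wj].
  - by case: s => /=; have := g0 i; rewrite ltr_norml; lra.
  - by apply: cvgB => //; case: s => /=; apply: cvgB.
  - have D1 := Dp i t tb; have D2 := Dq i t tb; have D3 := Dg t tb.
    by case: s => /=; apply: is_deriveB; apply: is_deriveB.
  rewrite subr_lt0; apply: Hd => //.
  - by case: s {w0} => /=; [left|right].
  - by lra.
  - by move=> j; have := wj (j, s); rewrite /=; lra.
  - by move=> j; have := wj (j, ~~ s); rewrite /= negbK; lra.
have := H (i, true); have := H (i, false); rewrite /= ltr_norml; lra.
Qed.

(** The one-sided contraction property; with [m = 0] it says that the drift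
    at [i] increases with the other coordinates. *)
Lemma drift_mono kap u v i (m : R) :
  (forall j, 0 <= u j) -> (forall j, 0 <= v j) -> 0 <= m ->
  u i = v i + m -> (forall j, u j <= v j + m) -> drift kap u i <= drift kap v i.
Proof.
move=> u0 v0 m0 ui uj; rewrite /drift lerD2l lerN2 ler_pM2l//.
exact: angle_sum_le uj.
Qed.

(** The distance stays below every affine function [eps * (1 + s)]: its
    drift is nonpositive, and the slope of the affine function is positive. *)
Lemma solution_unique kap (p q : 'I_N -> R -> R) b :
  solution kap p b -> solution kap q b -> (forall i, p i 0 = q i 0) ->
  forall i t, 0 <= t <= b -> p i t = q i t.
Proof.
move=> sp sq pq i t tb; apply/eqP; rewrite -subr_eq0 -normr_le0.
apply/ler_addgt0Pr => e e0; rewrite add0r.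
pose g : R -> R := fun s => e / (1 + t) * (1 + s).
have t0 : 0 < 1 + t by lra.
have et : 0 < e / (1 + t) by rewrite divr_gt0.
have Dg (s : R) : is_derive s 1 g (e / (1 + t)).
  have -> : g = (e / (1 + t)) \*: (cst 1 + id) by apply/funext.
  by apply: is_derive_eq; rewrite add0r /GRing.scale/= mulr1.
have gt0 s : 0 <= s -> 0 < g s by move=> s0; rewrite mulr_gt0//; lra.
have : `|p i t - q i t| < g t.
  apply: (comparison (dg := fun=> e / (1 + t)) sp sq) => //.
  - apply: cvg_at_right_filter; exact: is_derive_continuous (Dg 0).
  - by move=> j; rewrite pq subrr normr0 gt0.
  move=> j s u v sb uv uj uk _; have := gt0 s; have sb' : 0 <= s <= b by lra.
  case: sp sq => [_ p0 _] [_ q0 _] => gs.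
  have [u0 v0] : (forall j, 0 < u j) /\ (forall j, 0 < v j).
    by case: uv => -[-> ->]; split=> k; auto.
  apply: (@le_lt_trans _ _ 0) => //; rewrite subr_le0.
  apply: (@drift_mono _ _ _ _ (g s)) => // [k|k|]; rewrite ltW//.
  by apply: gs; lra.
by rewrite /g divfK ?gt_eqF// => /ltW.
Qed.

Lemma angle_sum_const_cvg i :
  angle_sum (fun=> x) i @[x --> +oo] --> character Phi i / 2.
Proof.
rewrite /angle_sum mulr_suml; apply: cvg_big => [|d _].
  by apply: add_continuous.
exact: angle_diag_cvg.
Qed.

(** Perron's method. The supremum of the subsolutions is a subsolution
    because raising the other coordinates increases the drift. If its drift
    at [i] were positive, raising its coordinate [i] slightly would give a
    larger subsolution. *)
Lemma exists_equilibrium kap : (forall i, 0 < kap i < character Phi i) ->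
  exists p, (forall i, 0 < p i) /\ (forall i, drift kap p i = 0).
Proof.
move=> kapb.
have k0 i : 0 < kap i by case/andP: (kapb i).
have [e [e0 _ He]] := exists_barrier k0
  (fun i : 'I_N => ltr01 : 0 < (fun=> 1 : R) i).
have [L L0 HL] := drift_lipschitz kap.
have [P eP HP] : exists2 P : R, e <= P & forall i, drift kap (fun=> P) i < 0.
  have H : \forall x \near +oo,
      (forall i, kap i / 2 < angle_sum (fun=> x) i) /\ e <= x.
    near=> x; split.
      near: x; apply: (@filter_forall _ _
        (fun i x => kap i / 2 < angle_sum (fun=> x) i) +oo) => i.
      apply: (cvgr_gt (character Phi i / 2) (@angle_sum_const_cvg i)).
      by case/andP: (kapb i) => _ ki; rewrite ltr_pM2r.
    by near: x; apply: nbhs_pinfty_ge; rewrite num_real.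
  have [P [HP eP]] := filter_ex H.
  by exists P => // i; have := HP i; rewrite /drift; lra.
pose S := [set u : 'I_N -> R |
  (forall j, e <= u j <= P) /\ forall j, 0 <= drift kap u j].
have Se : S (fun=> e).
  by split=> [j|j]; [rewrite lexx|rewrite ltW// He].
pose p i := sup [set u i | u in S].
have hS i : has_sup [set u i | u in S].
  split; first by exists e, (fun=> e).
  by exists P => _ [u [uP _] <-]; case/andP: (uP i).
have Sp u i : S u -> u i <= p i.
  by move=> Su; apply: sup_upper_bound => //; exists u.
have ep i : e <= p i by exact: (Sp _ i Se).
have pP i : p i <= P.
  apply: sup_le_ub => [|_ [u [uP _] <-]]; first by case: (hS i).
  by case/andP: (uP i).
have p0 i : 0 < p i by apply: lt_le_trans (ep i).
have pos u : (forall j, e <= u j) -> forall j, 0 <= u j.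
  by move=> eu j; apply: le_trans (ltW e0) (eu j).
have drift_ge0 i : 0 <= drift kap p i.
  rewrite leNgt; apply/negP => fi.
  pose eta := - drift kap p i / (2 * L).
  have eta0 : 0 < eta by rewrite divr_gt0 ?oppr_gt0 ?mulr_gt0.
  have [_ [u Su <-] ui] := sup_adherent eta0 (hS i).
  have up j := Sp u j Su.
  pose z j := if j == i then u i else p j.
  have zi : z i = u i by rewrite /z eqxx.
  have uz j : u j <= z j by rewrite /z; case: eqP => [->//|_]; exact: up.
  have eu j : e <= u j by case: Su => /(_ j)/andP[].
  have uf : drift kap u i <= drift kap z i.
    apply: (@drift_mono _ _ _ _ 0); rewrite ?addr0 ?zi//.
    - exact: pos.
    - by apply: pos => j; apply: le_trans (uz j).
    - by move=> j; rewrite addr0.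
  have zp k : `|z k - p k| <= eta.
    rewrite /z; case: eqP => [->|_]; last by rewrite subrr normr0 ltW.
    by rewrite ler_norml; move: ui (up i); rewrite -/(p i); lra.
  have Le : L * eta = - drift kap p i / 2.
    by rewrite /eta; field; rewrite gt_eqF.
  have := HL z p eta i zp; rewrite Le ler_norml.
  by have := Su.2 i; lra.
exists p; split=> // i; apply/eqP; rewrite eq_le drift_ge0 andbT.
rewrite leNgt; apply/negP => fi.
have pPi : p i < P.
  rewrite lt_neqAle pP andbT; apply/eqP => piP.
  have : drift kap p i <= drift kap (fun=> P) i.
    apply: (@drift_mono _ _ _ _ 0) => //; rewrite ?addr0//.
    - by move=> j; exact: ltW.
    - by move=> _; apply: le_trans eP; exact: ltW.
  by have := HP i; lra.
pose eta := Num.min (P - p i) (drift kap p i / L).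
have eta0 : 0 < eta by rewrite lt_min subr_gt0 pPi divr_gt0.
have eta1 : eta <= P - p i by rewrite ge_min lexx.
have eta2 : L * eta <= drift kap p i.
  by rewrite mulrC -ler_pdivlMr// ge_min lexx orbT.
pose z j := if j == i then p i + eta else p j.
have zi : z i = p i + eta by rewrite /z eqxx.
have pz j : p j <= z j by rewrite /z; case: eqP => [->|//]; lra.
have Sz : S z.
  split=> [j|j].
    rewrite (le_trans (ep j) (pz j))/= /z; case: eqP => _; first lra.
    exact: pP.
  have [->|ji] := eqVneq j i.
    have := HL z p eta i; have zp k : `|z k - p k| <= eta.
      rewrite /z; case: eqP => [->|_]; last by rewrite subrr normr0 ltW.
      by rewrite addrC addKr ger0_norm// ltW.
    by move=> /(_ zp); rewrite ler_norml; lra.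
  apply: le_trans (drift_ge0 j) _.
  apply: (@drift_mono _ _ _ _ 0); rewrite ?addr0//.
  - by move=> k; exact: ltW.
  - by apply: pos => k; apply: le_trans (ep k) (pz k).
  - by rewrite /z (negbTE ji).
  - by move=> k; rewrite addr0.
by have := Sp z i Sz; rewrite zi; lra.
Unshelve. all: by end_near. Qed.

Lemma equilibrium_solution kap u b : (forall i, 0 < u i) ->
  (forall i, drift kap u i = 0) -> solution kap (fun i _ => u i) b.
Proof.
move=> u0 fu; split=> [i|i t _|i t _]; first exact: cvg_cst.
  exact: u0.
by rewrite fu; exact: is_derive_cst.
Qed.

(** As long as the distance [m] to the equilibrium is at most [delta], all
    the values are bounded, so that the gain in [angle_sum_increment] is at
    least a fixed multiple of [m]. It is positive because each vertex
    carries a dart. *)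
Lemma solution_cvg_equilibrium kap u (delta : R) :
  (forall i, exists d, org d = i) ->
  (forall i, 0 < u i) -> (forall i, drift kap u i = 0) -> 0 < delta ->
  exists2 c : R, 0 < c &
    forall (p : 'I_N -> R -> R) (b : R), solution kap p b ->
    (forall i, `|p i 0 - u i| < delta) ->
    forall i t, 0 <= t <= b -> `|p i t - u i| < delta * expR (- c * t).
Proof.
move=> dart_at u0 fu d0.
(* [u i + u j] is at most [2 * \sum_i u i], also when [i = j]. *)
pose B := 2 * (\sum_i u i) + 2 * delta.
have uB i j : u i + u j + 2 * delta <= B.
  have le_sum k : u k <= \sum_k u k.
    by rewrite (bigD1 k)//= lerDl sumr_ge0// => l _; exact: ltW.
  by rewrite /B; have := le_sum i; have := le_sum j; lra.
have [c c0 Hc] := @exists_below R _ (fun d => dcoarg (Phi (edge_of d)) B)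
  (fun d => dcoarg_gt0 B (Phi_bounds (edge_of d))).
exists c => // p b sp p0.
pose g (t : R) := delta * expR (- c * t).
have g0 t : 0 < g t by rewrite mulr_gt0// expR_gt0.
have gd (t : R) : 0 <= t -> g t <= delta.
  move=> t0; rewrite -[leRHS]mulr1 ler_wpM2l ?(ltW d0)// -expR0 ler_expR.
  by rewrite mulNr oppr_le0 mulr_ge0// ltW.
have Dg (t : R) : is_derive t 1 g (- c * g t) by exact: is_derive_expZ.
apply: (comparison (g := g) (dg := fun t => - c * g t) sp
  (equilibrium_solution b u0 fu)) => //.
- by apply: cvg_at_right_filter; exact: is_derive_continuous (Dg 0).
- by rewrite /g mulr0 expR0 mulr1.
move=> i t v w tb vw vi vj wj; have tb' : 0 <= t <= b by lra.
have tp : 0 <= t by lra.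
have [v0 w0] : (forall j, 0 < v j) /\ (forall j, 0 < w j).
  case: sp => _ sp _.
  by case: vw => -[-> ->]; split=> // j; exact: sp.
have wB j : w i + w j + 2 * g t <= B.
  have := gd t tp; have := uB i j.
  by case: vw vi vj wj => -[-> ->] vi vj wj; have := wj j; lra.
have [d di] := dart_at i.
have := @angle_sum_increment v w i (g t) B (fun j => ltW (v0 j))
  (fun j => ltW (w0 j)) (ltW (g0 t)) vi vj wB.
have : dcoarg (Phi (edge_of d)) B * (2 * g t) <=
    \sum_(d | org d == i) dcoarg (Phi (edge_of d)) B * (2 * g t).
  rewrite (bigD1 d) ?di ?eqxx//= lerDl sumr_ge0// => e _.
  by apply: mulr_ge0; [rewrite ltW// dcoarg_gt0|rewrite mulr_ge0// ltW].
have : c * g t < dcoarg (Phi (edge_of d)) B * g t by rewrite ltr_pM2r.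
have := mulr_gt0 c0 (g0 t).
rewrite /drift; lra.
Qed.

Lemma solution_escape kap (p : 'I_N -> R -> R) (b a eta : R) :
  (forall i, eta < kap i - character Phi i) -> solution kap p b ->
  (forall i, a < p i 0) -> forall i t, 0 <= t <= b -> a + eta * t < p i t.
Proof.
move=> Heta [cp p0 Dp] a0 i t tb; rewrite -subr_lt0.
have Dl (s : R) : is_derive s 1 (fun s : R => a + eta * s) eta.
  have -> : (fun s : R => a + eta * s) = cst a + eta \*: id by apply/funext.
  by apply: is_derive_eq; rewrite add0r /GRing.scale/= mulr1.
apply: (@max_principle _ _ (fun i t => a + eta * t - p i t)
  (fun i t => eta - drift kap (p^~ t) i) b)
  => // {i t tb} [i|i|i t tb|i t tb w0 wj].
- by rewrite mulr0 addr0 subr_lt0.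
- apply: cvgB; last exact: cp.
  by apply: cvg_at_right_filter; exact: is_derive_continuous (Dl 0).
- by have D1 := Dp i t tb; apply: is_deriveB.
have tb' : 0 <= t <= b by lra.
have := @angle_sum_min (p^~ t) i (ltW (p0 i t tb')).
have pm j : p i t <= p j t by have := wj j; lra.
by move=> /(_ pm); have := Heta i; rewrite /drift; lra.
Qed.

(** Strictness at the minimum requires a dart there. Without one, the sum of
    the angles is [0], and [kap] is positive. *)
Lemma no_equilibrium kap u : (0 < N)%N ->
  (forall i, 0 < kap i) -> (forall i, character Phi i <= kap i) ->
  (forall i, 0 < u i) -> ~ (forall i, drift kap u i = 0).
Proof.
move=> N0 k0 ck u0 fu.
pose i0 := Ordinal N0.
have [i _ ui] := @arg_minP _ _ 'I_N i0 xpredT u isT.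
have um j : u i <= u j by exact: ui.
have f0 := fu i; have := ck i; have := k0 i.
have [[d di]|nd] := pselect (exists d, org d = i).
  have := angle_sum_min_lt di (ltW (u0 i)) um.
  by move: f0; rewrite /drift; lra.
move: f0; rewrite /drift /angle_sum big1 => [|d /eqP di]; first by lra.
by case: nd; exists d.
Qed.

(** The total angle that the curvature [Kbar] prescribes around each vertex. *)
Definition cone_angle (Kbar : 'rV[R]_N) i : R := 2 * pi - Kbar ord0 i.

Variable Kbar : 'rV[R]_N.

Lemma curvature_tau (r : 'rV[R]_N) i : circle_pattern r ->
  curvature Phi r ord0 i = 2 * pi - 2 * angle_sum (fun j => tau (r ord0 j)) i.
Proof.
move=> r0; rewrite mxE; congr (_ - 2 * _); apply: eq_bigr => d _.
rewrite -[r ord0 i in LHS]tauK// -[r ord0 (org _) in LHS]tauK//.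
by rewrite theta_tau// tau_gt0.
Qed.

(** The factor [sinh r_i] of the flow cancels against the derivative [- 1 /
    sinh r_i] of [tau]. *)
Lemma flow_solution_tau (A : set R) (r : R -> 'rV[R]_N) (b : R) : 0 <= b ->
  (forall t, 0 <= t <= b -> A t) -> (forall t, 0 < t <= b -> nbhs t A) ->
  (\forall t \near 0^'+, A t) ->
  flow_solution Phi Kbar A r ->
  solution (cone_angle Kbar) (fun i t => tau (r t ord0 i)) b.
Proof.
move=> b0 Ab Anb A0 fr.
have r0 t i : 0 <= t <= b -> 0 < r t ord0 i.
  by move=> /Ab/fr[+ _]; exact.
split=> [i|i t tb|i t tb].
- have A00 : A 0 by apply: Ab; rewrite lexx.
  have [_ /(_ i) Hd] := fr 0 A00.
  have H0 : r x ord0 i @[x --> 0^'+] --> r 0 ord0 i.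
    apply: (slope_continuous_right
      (l := (Kbar ord0 i - curvature Phi (r 0) ord0 i) * sinh (r 0 ord0 i))).
    apply: cvg_within_sub A0 Hd => P.
    apply: (@filterS _ (nbhs (0 : R))) => x H x0.
    by apply: H; rewrite gt_eqF.
  have r00 : 0 < r 0 ord0 i by apply: r0; rewrite lexx.
  have ct := is_derive_continuous (is_derive_tau r00).
  exact: (cvg_comp _ _ H0 ct).
- by apply: tau_gt0; exact: r0.
have tb' : 0 <= t <= b by lra.
have [cp /(_ i) Hd] := fr t (Ab t tb').
have Dr : is_derive t 1 (fun s => r s ord0 i)
   ((Kbar ord0 i - curvature Phi (r t) ord0 i) * sinh (r t ord0 i)).
  apply/is_derive_slopeP; apply: cvg_within_sub Hd => //.
  by have := Anb t tb; apply: (@filterS _ (nbhs t)) => x Ax _.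
have Dtau := @is_derive1_comp R (@tau R) (fun s => r s ord0 i) t _ _
  (is_derive_tau (r0 t i tb')) Dr.
apply: (is_derive_eq Dtau).
rewrite /drift /cone_angle curvature_tau//.
have := sinh_gt0 (r0 t i tb'); set s := sinh _ => s0.
by field; rewrite gt_eqF.
Qed.

Lemma flow_solution_of_drift (p : 'I_N -> R -> R) :
  (forall i t, 0 <= t -> 0 < p i t) ->
  (forall i (t : R), 0 <= t ->
    is_derive t 1 (p i) (drift (cone_angle Kbar) (p^~ t) i)) ->
  flow_solution Phi Kbar [set t | 0 <= t] (fun t => \row_i tau (p i t)).
Proof.
move=> p0 Dp t /= t0.
have cp : circle_pattern (\row_i tau (p i t)).
  by move=> i; rewrite mxE tau_gt0// p0.
split=> // i.
have Dtau := @is_derive1_comp R (@tau R) (p i) t _ _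
  (is_derive_tau (p0 i t t0)) (Dp i t t0).
have -> : (fun s => (\row_i0 tau (p i0 s)) ord0 i) = @tau R \o p i.
  by apply/funext => s; rewrite mxE.
have E : - (sinh (p i t))^-1 * drift (cone_angle Kbar) (p^~ t) i =
    (Kbar ord0 i - curvature Phi (\row_i tau (p i t)) ord0 i) *
    sinh ((\row_i tau (p i t)) ord0 i).
  rewrite curvature_tau// mxE sinh_tauV ?p0// /drift /cone_angle.
  have -> : (fun j => tau ((\row_k tau (p k t)) ord0 j)) = p^~ t.
    by apply/funext => j; rewrite mxE tauK// p0.
  by ring.
rewrite E in Dtau; move/is_derive_slopeP : Dtau.
move=> H P /H; apply: (@filterS _ (nbhs t)) => x Hx xt _.
exact: Hx.
Qed.

End System.

(** * The prescribed curvature flow *)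

Section Flow.
Variables (R : realType) (N : nat) (D : cellular_decomposition N).
Variables (Phi : edge D -> R) (Kbar : 'rV[R]_N).
Hypothesis Phi_bounds : forall e, 0 < Phi e < pi.
Hypothesis Kbar_lt : forall i, Kbar ord0 i < 2 * pi.

Let kap := cone_angle Kbar.

Lemma cone_angle_gt0 i : 0 < kap i.
Proof. by rewrite /kap /cone_angle subr_gt0. Qed.

Lemma global_solution (u : 'I_N -> R) : (forall i, 0 < u i) ->
  exists p : 'I_N -> R -> R, [/\ forall i, p i 0 = u i,
    forall i (t : R), 0 <= t -> is_derive t 1 (p i) (drift Phi kap (p^~ t) i) &
    forall i t, 0 <= t -> 0 < p i t].
Proof.
move=> u0; have [L L0 HL] := drift_lipschitz Phi_bounds kap.
have [p [p0 Dp]] := picard L0 HL u.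
exists p; split=> // i t t0.
have [e [e0 eu He]] := exists_barrier Phi_bounds cone_angle_gt0 u0.
apply: lt_trans e0 _.
apply: (@solution_gt _ _ _ Phi kap p t e) => // [j|j s st|j|].
- apply: cvg_at_right_filter.
  exact: is_derive_continuous (Dp j 0 (lexx _)).
- by apply: Dp; lra.
- by rewrite p0.
- by rewrite lexx t0.
Qed.

Lemma flow_solution_ge0 (r : R -> 'rV[R]_N) (b : R) : 0 <= b ->
  flow_solution Phi Kbar [set t | 0 <= t] r ->
  solution Phi kap (fun i t => tau (r t ord0 i)) b.
Proof.
move=> b0; apply: flow_solution_tau => // [t|t|].
- by case/andP.
- move=> /andP[t0 _]; near=> s; rewrite /= ltW//; near: s.
  exact: lt_nbhsr.
- by near=> s; rewrite /= ltW.
Unshelve. all: by end_near. Qed.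

Lemma flow_solution_exists_unique (r0 : 'rV[R]_N) : circle_pattern r0 ->
    exists r : R -> 'rV[R]_N,
      [/\ r 0 = r0,
          flow_solution Phi Kbar [set t | 0 <= t] r &
          forall (T : \bar R) (s : R -> 'rV[R]_N),
            s 0 = r0 ->
            flow_solution Phi Kbar [set t | 0 <= t /\ (t%:E < T)%E] s ->
            forall t, 0 <= t -> (t%:E < T)%E -> s t = r t].
Proof.
move=> r0p; have [p [p0 Dp pp]] := @global_solution (fun i => tau (r0 ord0 i))
  (fun i => tau_gt0 (r0p i)).
have fp := flow_solution_of_drift Phi_bounds pp Dp.
have r00 : \row_i tau (p i 0) = r0.
  by apply/rowP => i; rewrite mxE p0 tauK.
exists (fun t => \row_i tau (p i t)); split=> // T s s0 fs t t0 tT.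
have sols : solution Phi kap (fun i t => tau (s t ord0 i)) t.
  apply: flow_solution_tau fs => // [x /andP[x0 xt]|x /andP[x0 xt]|].
  - by split=> //; apply: le_lt_trans tT; rewrite lee_fin.
  - have xT : (x%:E < T)%E by apply: le_lt_trans tT; rewrite lee_fin.
    near=> y; split; first by rewrite ltW//; near: y; exact: lt_nbhsr.
    by near: y; exact: nbhs_lt_ereal.
  - have T0 : (0%:E < T)%E by apply: le_lt_trans tT; rewrite lee_fin.
    near=> y; split; first by rewrite ltW.
    near: y; apply: cvg_at_right_filter; first exact: cvg_id.
    exact: nbhs_lt_ereal.
have solp := flow_solution_ge0 t0 fp.
have st : s t ord0 =1 (\row_i tau (p i t)) ord0.
  move=> i; have := solution_unique Phi_bounds sols solp.
  rewrite s0 r00 => /(_ (fun=> erefl) i t); rewrite t0 lexx => /(_ isT) e.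
  rewrite -[LHS]tauK; last by have [+ _] := fs t (conj t0 tT); exact.
  by rewrite e tauK// mxE tau_gt0// pp.
by apply/rowP.
Unshelve. all: by end_near. Qed.

(** The map [tau] is Lipschitz away from [0] only, hence the common lower
    bound [e] for the solution and the equilibrium. *)
Lemma flow_cvg_equilibrium (u : 'I_N -> R) (r : R -> 'rV[R]_N) :
  (forall i, exists d : dart D, org d = i) ->
  (forall i, 0 < u i) -> (forall i, drift Phi kap u i = 0) ->
  flow_solution Phi Kbar [set t | 0 <= t] r ->
  cvg_exponentially r (\row_i tau (u i)).
Proof.
move=> dart_at u0 fu fr.
pose p i t := tau (r t ord0 i).
have r0 t i : 0 <= t -> 0 < r t ord0 i.
  by move=> t0; have [+ _] := fr t t0; exact.
have p0 i : 0 < p i 0 by rewrite tau_gt0// r0.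
pose delta := 1 + \sum_i `|p i 0 - u i|.
have pd i : `|p i 0 - u i| < delta.
  rewrite /delta (bigD1 i)//=.
  have : 0 <= \sum_(j | j != i) `|p j 0 - u j| by exact: sumr_ge0.
  by lra.
have d0 : 0 < delta by rewrite ltr_pwDl// sumr_ge0.
have [c c0 Hc] := solution_cvg_equilibrium Phi_bounds dart_at u0 fu d0.
have [e [e0 em He]] := @exists_barrier _ _ _ _ Phi_bounds kap
  (fun i => Num.min (p i 0) (u i)) cone_angle_gt0
  (fun i => ltac:(by rewrite lt_min p0 u0)).
have ep i : e < p i 0 by have := em i; rewrite lt_min => /andP[].
have eu i : e < u i by have := em i; rewrite lt_min => /andP[].
have se : 0 < (sinh e)^-1 by rewrite invr_gt0 sinh_gt0.
exists ((sinh e)^-1 * delta), c; split; first by rewrite mulr_gt0.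
split=> // t t0; have sol := flow_solution_ge0 t0 fr.
apply: row_norm_le => [|i]; first by rewrite !mulr_ge0 ?expR_ge0 ?ltW.
rewrite !mxE -[r t ord0 i]tauK ?r0// -mulrA.
apply: le_trans (tau_lipschitz e0 _ (ltW (eu i))) _.
  apply/ltW; case: sol => cp _ Dp.
  by apply: (solution_gt cp Dp ep He); rewrite t0 lexx.
rewrite ler_pM2l// ltW//; apply: (Hc _ _ sol pd).
by rewrite t0 lexx.
Qed.

Lemma equilibrium_curvature (r : 'rV[R]_N) : circle_pattern r ->
  curvature Phi r = Kbar <->
  forall i, drift Phi kap (fun j => tau (r ord0 j)) i = 0.
Proof.
move=> rp; split=> [rK i|fr].
  by rewrite /drift /kap /cone_angle -rK curvature_tau//; ring.
apply/rowP => i; rewrite curvature_tau//.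
have := fr i; rewrite /drift /kap /cone_angle; lra.
Qed.

End Flow.

Theorem theorem1p11 (R : realType) (N : nat) (D : cellular_decomposition N)
    (Phi : edge D -> R) (Kbar : 'rV[R]_N)
    (Phi_bounds : forall e, 0 < Phi e < pi)
    (Kbar_lt : forall i, Kbar ord0 i < 2 * pi) :
  (forall r0 : 'rV[R]_N, circle_pattern r0 ->
    exists r : R -> 'rV[R]_N,
      [/\ r 0 = r0,
          flow_solution Phi Kbar [set t | 0 <= t] r &
          forall (T : \bar R) (s : R -> 'rV[R]_N),
            s 0 = r0 ->
            flow_solution Phi Kbar [set t | 0 <= t /\ (t%:E < T)%E] s ->
            forall t, 0 <= t -> (t%:E < T)%E -> s t = r t]) /\
  ((forall i, 2 * pi - character Phi i < Kbar ord0 i < 2 * pi) ->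
    exists rbar : 'rV[R]_N,
      unique (fun x : 'rV[R]_N => circle_pattern x /\ curvature Phi x = Kbar)
        rbar /\
      forall r : R -> 'rV[R]_N,
        flow_solution Phi Kbar [set t | 0 <= t] r -> cvg_exponentially r rbar) /\
  ((forall i, Kbar ord0 i <= 2 * pi - character Phi i) ->
    ~ exists rbar : 'rV[R]_N,
        circle_pattern rbar /\ curvature Phi rbar = Kbar) /\
  ((forall i, Kbar ord0 i < 2 * pi - character Phi i) ->
    forall r : R -> 'rV[R]_N,
      flow_solution Phi Kbar [set t | 0 <= t] r -> cvg_exponentially r 0).
Proof.
pose kap := cone_angle Kbar.
have k0 := cone_angle_gt0 Kbar_lt.
split; first exact: flow_solution_exists_unique.
split=> [Kb|].
  have kb i : 0 < kap i < character Phi i.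
    by rewrite k0 /kap /cone_angle; have := Kb i; lra.
  have dart_at i : exists d : dart D, org d = i.
    apply: contrapT => nd; have := kb i.
    rewrite /character big1 => [|d /eqP di].
      by lra.
    by case: nd; exists d.
  have [u [u0 fu]] := exists_equilibrium Phi_bounds kb.
  have cvgu r :=
    @flow_cvg_equilibrium _ _ _ _ _ Phi_bounds Kbar_lt u r dart_at u0 fu.
  have up : circle_pattern (\row_i tau (u i)).
    by move=> i; rewrite mxE tau_gt0.
  exists (\row_i tau (u i)); split=> //; split.
    split=> //; apply/equilibrium_curvature => // i.
    rewrite (_ : (fun j => _) = u)//; apply/funext => j.
    by rewrite mxE tauK.
  (* Another pattern with this curvature is a constant solution. *)
  move=> y [yp yK]; apply/esym/cvg_exponentially_cst; apply: cvgu => t _.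
  split=> // i; rewrite yK subrr mul0r.
  have /is_derive_slopeP := is_derive_cst (y ord0 i) t 1.
  by move=> Hd P /Hd; apply: (@filterS _ (nbhs t)) => x Hx xt _; exact: Hx.
split=> [Kb [rbar [rp /(equilibrium_curvature _ Phi_bounds rp)]]|Kb r fr].
  apply: no_equilibrium => //.
  - exact: vertices_nonempty D.
  - by move=> i; rewrite /cone_angle; have := Kb i; lra.
  - by move=> i; exact: tau_gt0.
have [eta eta0 He] := @exists_below R _ (fun i => kap i - character Phi i)
   (fun i => ltac:(rewrite /kap /cone_angle; have := Kb i; lra)).
have r0 t i : 0 <= t -> 0 < r t ord0 i.
  by move=> t0; have [+ _] := fr t t0; exact.
have [a a0 Ha] := @exists_below R _ (fun i => tau (r 0 ord0 i))
   (fun i => tau_gt0 (r0 0 i (lexx _))).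
have /andP[ea0 ea1] := expN_itv a0.
exists (2 / (1 - expR (- a)) * expR (- a)), eta; split.
  by rewrite !mulr_gt0// invr_gt0 subr_gt0.
split=> // t t0; have sol := flow_solution_ge0 Phi_bounds t0 fr.
apply: row_norm_le => [|i].
  by rewrite !mulr_ge0 ?expR_ge0// invr_ge0 subr_ge0 ltW.
rewrite subr0 gtr0_norm ?r0// -[r t ord0 i]tauK ?r0//.
have := @solution_escape _ _ _ _ Phi_bounds _ _ _ _ _ He sol Ha i t.
rewrite t0 lexx => /(_ isT) Hp.
have et : 0 <= eta * t by rewrite mulr_ge0// ltW.
have ap : a <= tau (r t ord0 i) by lra.
apply: le_trans (tau_le_exp a0 ap) _.
rewrite -[leRHS]mulrA -expRD ler_pM2l ?divr_gt0 ?subr_gt0// ler_expR.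
lra.
Qed.
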